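(* Let $M=M^2\times\mathbb{S}^2$ carry the spherically symmetric metric $$ds^2=h_{AB}(x)\,dx^Adx^B+r^2(x)\,d\Omega^2,\qquad dr\neq0,$$ where $(M^2,h_{AB})$ is a connected oriented 2-dimensional Lorentzian manifold with volume form $\epsilon_{AB}$, $r>0$ is a smooth function on $M^2$, and $d\Omega^2$ is the canonical metric on the unit sphere. Within the spherically symmetric class, every closed conformal Killing--Yano 2-form is, up to an overall (constant) normalization, $$Y=r\,\epsilon,\quad\text{i.e. } Y_{AB}=r\,\epsilon_{AB},$$ with all other components zero, and its associated vector field is unique up to normalization and is precisely the Kodama vector field $$\xi^A=-\epsilon^{AB}\nabla_Br,\qquad \xi^i=0.$$
   Context: Indices $A,B$ refer to $M^2$ and $i,j$ to $\mathbb{S}^2$. Conformal Killing--Yano (CKY) 2-form on an $n$-dimensional pseudo-Riemannian manifold: a smooth 2-form $Y_{ab}$ with $\nabla_cY_{ab}=g_{ca}\xi_b-g_{cb}\xi_a+z_{abc}$, where $z_{abc}$ is totally antisymmetric and $\xi_a=\frac{1}{n-1}\nabla^bY_{ba}$ (here $n=4$); $\xi^a$ is its associated vector field. It is closed if $dY=0$ (equivalently $z_{abc}=0$). Spherically symmetric 2-forms are those of the form $Y=Q_1(x)\,\epsilon_h+Q_2(x)\,\omega_{\mathbb{S}^2}$, where $Q_1,Q_2$ are functions on $M^2$, $\epsilon_h$ is the volume form of $h$, and $\omega_{\mathbb{S}^2}$ is the volume form of the unit sphere. *)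

(* Defs.v *)
From HB Require Import structures.
From mathcomp Require Import all_boot all_order all_algebra.
From mathcomp Require Import ring lra.
From mathcomp Require Import all_classical all_reals all_analysis.

Set Implicit Arguments.
Unset Strict Implicit.
Unset Printing Implicit Defensive.

Import Order.TTheory GRing.Theory Num.Theory.
Import numFieldNormedType.Exports.

Local Open Scope classical_set_scope.
Local Open Scope ring_scope.

(* [Ck k U f], for an open [U] of R^n: the iterated partial derivatives of [f]
   of order at most [k] exist and are continuous on [U]. *)
Fixpoint Ck (R : realType) (n k : nat) (U : set 'rV[R]_n) (f : 'rV[R]_n -> R)
    : Prop :=
  (forall x, U x -> {for x, continuous f}) /\
  if k is k'.+1 then
    forall a : 'I_n, (forall x, U x -> derivable f x (delta_mx 0 a)) /\
                     Ck k' U (fun x => 'D_(delta_mx 0 a) f x)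
  else True.

Definition smooth_on (R : realType) (n : nat) (U : set 'rV[R]_n)
    (f : 'rV[R]_n -> R) : Prop :=
  forall k, Ck k U f.

(* A space with a family of charts (an atlas, once [smooth_manifold] holds).
   Only the values of [co i] on [dom i], and of its inverse [par i] on
   [co i @` dom i], are meaningful; accordingly all fields below are only
   constrained on the domains of the charts. *)
Record charted_space (R : realType) (n : nat) := ChartedSpace {
  carrier :> topologicalType;
  idx : Type;
  dom : idx -> set carrier;
  co : idx -> carrier -> 'rV[R]_n;
  par : idx -> 'rV[R]_n -> carrier }.

Section Manifolds.
Context (R : realType) (n : nat) (M : charted_space R n).
Implicit Types (i j : idx M) (p : M) (f : M -> R).

(* partial derivative with respect to the [a]-th coordinate of the chart [i] *)
Definition pd i (a : 'I_n) f p : R :=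
  'D_(delta_mx 0 a) (f \o par i) (co i p).

Definition smooth_fun f : Prop :=
  forall i, smooth_on (co i @` dom i) (f \o par i).

(* entry (c, a) is the derivative of the c-th coordinate of the chart [j] with
   respect to the a-th coordinate of the chart [i] *)
Definition jac i j p : 'M[R]_n :=
  \matrix_(c < n, a < n) pd i a (fun q => co j q 0 c) p.

Definition smooth_manifold : Prop :=
  [/\ hausdorff_space M, @second_countable M,
      forall p, exists i, dom i p,
      forall i, [/\ open (dom i), open (co i @` dom i),
        forall p, dom i p -> par i (co i p) = p,
        forall p, dom i p -> {for p, continuous (co i)} &
        forall x, (co i @` dom i) x -> {for x, continuous (par i)}] &
      forall i j (c : 'I_n),
        smooth_on (co i @` (dom i `&` dom j)) (fun x => co j (par i x) 0 c)].

(* The orientation is the one for which the charts of the atlas are positive. *)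
Definition oriented : Prop :=
  forall i j p, dom i p -> dom j p -> 0 < \det (jac i j p).

(* components, in every chart, of a covariant tensor of rank 2 *)
Definition tensor2 := idx M -> M -> 'M[R]_n.

(* components, in every chart, of a vector field *)
Definition vfield := idx M -> M -> 'rV[R]_n.

Definition is_tensor2 (T : tensor2) : Prop :=
  (forall i a b, smooth_on (co i @` dom i) (fun x => T i (par i x) a b)) /\
  (forall i j p, dom i p -> dom j p ->
     T i p = (jac i j p)^T *m T j p *m jac i j p).

Definition is_form2 (Y : tensor2) : Prop :=
  is_tensor2 Y /\ forall i p, dom i p -> (Y i p)^T = - Y i p.

Definition is_metric (g : tensor2) : Prop :=
  is_tensor2 g /\
  forall i p, dom i p -> (g i p)^T = g i p /\ g i p \in unitmx.

(* signature (-, +, ..., +) *)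
Definition lorentzian (g : tensor2) : Prop :=
  is_metric g /\
  forall i p, dom i p -> exists2 P : 'M[R]_n, P \in unitmx &
    P^T *m g i p *m P = diag_mx (\row_(a < n) (-1) ^+ (a == 0%N :> nat)).

Section LeviCivita.
Variable g : tensor2.

(* christoffel i a b c p is Gamma^a_bc at p *)
Definition christoffel i (a b c : 'I_n) p : R :=
  2^-1 * \sum_(d < n) invmx (g i p) a d *
    (pd i b (fun q => g i q d c) p + pd i c (fun q => g i q d b) p
     - pd i d (fun q => g i q b c) p).

(* nabla2 T i c a b p is (nabla_c T_ab) at p *)
Definition nabla2 (T : tensor2) i (c a b : 'I_n) p : R :=
  pd i c (fun q => T i q a b) p
  - \sum_(d < n) christoffel i d c a p * T i p d b
  - \sum_(d < n) christoffel i d c b p * T i p a d.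

(* xi_a = (n - 1)^-1 nabla^b Y_ba *)
Definition assoc_form (Y : tensor2) i (a : 'I_n) p : R :=
  (n%:R - 1)^-1 *
  \sum_(b < n) \sum_(c < n) invmx (g i p) b c * nabla2 Y i c b a p.

Definition assoc_vector (Y : tensor2) : vfield := fun i p =>
  \row_(a < n) \sum_(b < n) invmx (g i p) a b * assoc_form Y i b p.

Definition CKY (Y : tensor2) : Prop :=
  is_form2 Y /\
  exists z : idx M -> M -> 'I_n -> 'I_n -> 'I_n -> R,
    forall i p, dom i p -> forall a b c : 'I_n,
      [/\ z i p b a c = - z i p a b c, z i p a c b = - z i p a b c &
          nabla2 Y i c a b p =
            g i p c a * assoc_form Y i b p - g i p c b * assoc_form Y i a p
            + z i p a b c].

End LeviCivita.

(* dY = 0 *)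
Definition closed_form2 (Y : tensor2) : Prop :=
  forall i p, dom i p -> forall a b c : 'I_n,
    pd i a (fun q => Y i q b c) p + pd i b (fun q => Y i q c a) p
    + pd i c (fun q => Y i q a b) p = 0.

Definition closed_CKY (g Y : tensor2) : Prop := CKY g Y /\ closed_form2 Y.

End Manifolds.

Section Surfaces.
Context (R : realType) (M2 : charted_space R 2).

(* Volume form of a metric on an oriented surface; B - A is the Levi-Civita
   symbol [AB] on the indices 0, 1. *)
Definition vol (h : tensor2 M2) : tensor2 M2 := fun i p =>
  \matrix_(A < 2, B < 2)
    (Num.sqrt `|\det (h i p)| * ((B : nat)%:R - (A : nat)%:R)).

(* epsilon^AB = h^AC h^BD epsilon_CD *)
Definition vol_up (h : tensor2 M2) : idx M2 -> M2 -> 'M[R]_2 := fun i p =>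
  invmx (h i p) *m vol h i p *m (invmx (h i p))^T.

(* K^A = - epsilon^AB nabla_B r *)
Definition kodama (h : tensor2 M2) (r : M2 -> R) : vfield M2 := fun i p =>
  \row_(A < 2) - \sum_(B < 2) vol_up h i p A B * pd i B r p.

End Surfaces.

Section Sphere.
Variable R : realType.

Definition sphere : set 'rV[R]_3 := [set x | \sum_(k < 3) x 0 k ^+ 2 = 1].

(* stereographic projection from the pole (0, 0, (-1)^s), and its inverse *)
Definition stereo (s : bool) (x : 'rV[R]_3) : 'rV[R]_2 :=
  \row_(k < 2) (x 0 (widen_ord (leqnSn 2) k) / (1 - (-1) ^+ s * x 0 ord_max)).

Definition stereo_inv (s : bool) (u : 'rV[R]_2) : 'rV[R]_3 :=
  let m := \sum_(k < 2) u 0 k ^+ 2 in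
  \row_(k < 3)
    ([:: 2 * u 0 0; 2 * u 0 1; (-1) ^+ s * (m - 1)]`_k / (m + 1)).

Lemma stereo_inv_sphere s u : sphere (stereo_inv s u).
Proof.
rewrite /sphere /= !big_ord_recl big_ord0 !mxE !big_ord_recl !big_ord0 /=.
have -> : lift ord0 ord0 = 1 :> 'I_2 by apply/val_inj.
set a := u 0 0; set b := u 0 1; rewrite !addr0.
have m0 : a ^+ 2 + b ^+ 2 + 1 != 0.
  by rewrite lt0r_neq0 // ltr_wpDl // addr_ge0 ?sqr_ge0.
have -> : ((-1) ^+ s * (a ^+ 2 + b ^+ 2 - 1) / (a ^+ 2 + b ^+ 2 + 1)) ^+ 2
        = ((a ^+ 2 + b ^+ 2 - 1) / (a ^+ 2 + b ^+ 2 + 1)) ^+ 2.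
  by rewrite -mulrA exprMn sqrr_sign mul1r.
by field.
Qed.

Definition S2 : charted_space R 2 :=
  @ChartedSpace R 2 (set_type sphere) bool
    (fun s => [set x : set_type sphere | val x 0 ord_max != (-1) ^+ s])
    (fun s (x : set_type sphere) => stereo s (val x))
    (fun s u => exist _ (stereo_inv s u) (mem_set (stereo_inv_sphere s u))).

(* tangent vector of R^3 given by the partial derivative in the direction [i] of
   the inclusion of the sphere *)
Definition tangent (s : idx S2) (i : 'I_2) (x : S2) : 'rV[R]_3 :=
  \row_(k < 3) pd s i (fun y : S2 => (val y : 'rV[R]_3) 0 k) x.

(* the metric induced by the Euclidean metric of R^3 *)
Definition sphere_metric : tensor2 S2 := fun s x =>
  \matrix_(i < 2, j < 2) \sum_(k < 3) tangent s i x 0 k * tangent s j x 0 k.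

(* the volume form (u, v) |-> det (x, u, v), for the outward orientation *)
Definition sphere_vol : tensor2 S2 := fun s x =>
  \matrix_(i < 2, j < 2)
    \det (col_mx (val x : 'rV[R]_3) (col_mx (tangent s i x) (tangent s j x))).

End Sphere.

Definition prod_space (R : realType) (m n : nat) (M : charted_space R m)
    (N : charted_space R n) : charted_space R (m + n) :=
  @ChartedSpace R (m + n) (M * N)%type (idx M * idx N)%type
    (fun i => dom i.1 `*` dom i.2)
    (fun i p => row_mx (co i.1 p.1) (co i.2 p.2))
    (fun i x => (par i.1 (lsubmx x), par i.2 (rsubmx x))).

Section SphericalSymmetry.
Context (R : realType) (M2 : charted_space R 2).
Implicit Types (h : tensor2 M2) (r Q : M2 -> R).

Local Notation M := (prod_space M2 (S2 R)).

(* ds^2 = h_AB dx^A dx^B + r^2 dOmega^2 *)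
Definition spherical_metric h r : tensor2 M := fun i p =>
  block_mx (h i.1 p.1) 0 0 (r p.1 ^+ 2 *: sphere_metric i.2 p.2).

(* Q1 epsilon_h + Q2 omega *)
Definition spherical_form h Q1 Q2 : tensor2 M := fun i p =>
  block_mx (Q1 p.1 *: vol h i.1 p.1) 0 0 (Q2 p.1 *: sphere_vol i.2 p.2).

Definition spherically_symmetric h (Y : tensor2 M) : Prop :=
  exists Q1 Q2 : M2 -> R, forall (i : idx M) (p : M), dom i p ->
    Y i p = spherical_form h Q1 Q2 i p.

(* Y_AB = r epsilon_AB, all other components being 0 *)
Definition r_vol h r : tensor2 M := fun i p =>
  block_mx (r p.1 *: vol h i.1 p.1) 0 0 0.

(* xi^A = - epsilon^AB nabla_B r, xi^i = 0 *)
Definition kodama_field h r : vfield M := fun i p =>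
  row_mx (kodama h r i.1 p.1) 0.

End SphericalSymmetry.

(* Main.v *)
(** In the chart (i, j) of M^2 x S^2 the metric and every spherically symmetric
    form are block diagonal, with the blocks [l] (M^2) and [s] (S^2), and only
    the Christoffel symbols without sphere derivatives occur:
      Gamma^A_jk = - r gamma_jk grad^A r,   Gamma^j_Ak = (d_A r / r) delta^j_k,
    together with those of h. For Y = r eps this gives
    nabla_c Y_ab = g_ca xi_b - g_cb xi_a with xi_A = - eps_AB grad^B r and
    xi_i = 0. Taking the trace shows that xi is the associated form, and the
    cyclic sum shows that Y is closed.

    Conversely, let Y = Q1 eps + Q2 omega be a closed CKY form; then z = 0. The
    (C, i, j) components give Q2 d_C r = 0, so Q2 = 0. The (i, A, j) components
    give r xi_A = - Y_AB grad^B r; inserted into the (C, A, B) components this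
    gives r (d_C Q1) = Q1 (d_C r), so Q1 / r is constant on the connected
    surface M^2. *)

Require Import Defs.
From mathcomp Require Import all_boot all_order all_algebra.
From mathcomp Require Import ring lra.
From mathcomp Require Import all_classical all_reals all_analysis.

Set Implicit Arguments.
Unset Strict Implicit.
Unset Printing Implicit Defensive.

Import Order.TTheory GRing.Theory Num.Theory.
Import numFieldNormedType.Exports.

Local Open Scope classical_set_scope.
Local Open Scope ring_scope.

(** * Closure properties of C^k functions *)

(** Since [U] is open, agreement on [U] is agreement near each of its points and so passes to the
    partial derivatives. This allows a derivative to be replaced by a formula that is valid on [U]
    only. *)
Lemma Ck_eq (R : realType) n k (U : set 'rV[R]_n) f g :
  open U -> (forall x, U x -> f x = g x) -> Ck k U f -> Ck k U g.
Proof.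
move=> oU fg.
have near_fg (f' g' : 'rV[R]_n -> R) x : (forall x, U x -> f' x = g' x) -> U x ->
    \near x, f' x = g' x.
  by move=> e Ux; near=> y; apply: e; near: y; exact: open_nbhs_nbhs.
have ceq (f' g' : 'rV[R]_n -> R) : (forall x, U x -> f' x = g' x) ->
    (forall x, U x -> {for x, continuous f'}) ->
    forall x, U x -> {for x, continuous g'}.
  move=> e cf x Ux; rewrite /prop_for /continuous_at -(e _ Ux).
  by apply: cvg_trans (cf _ Ux); apply: (@near_eq_cvg _ _ (nbhs x)); exact: (near_fg _ _ _ e Ux).
elim: k f g fg => [|k IH] f g fg /= [cf df].
  by split=> //; exact: ceq cf.
split=> [|a]; first exact: ceq cf.
have [d1 d2] := df a; split=> [x Ux|].
  by apply: near_eq_derivable (d1 _ Ux); exact: (near_fg _ _ _ fg Ux).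
by apply: IH d2 => x Ux; apply: near_eq_derive; exact: (near_fg _ _ _ fg Ux).
Unshelve. all: by end_near. Qed.

Lemma Ck_pred (R : realType) n k (U : set 'rV[R]_n) f : Ck k.+1 U f -> Ck k U f.
Proof.
elim: k f => [|k IH] f; first by case.
move=> [cf df]; split=> // a; have [d1 d2] := df a; split=> [x Ux|]; [exact: d1|exact: IH d2].
Qed.

Lemma Ck_cst (R : realType) n k (U : set 'rV[R]_n) (c : R) : Ck k U (fun=> c).
Proof.
elim: k c => [|k IH] c; first by split=> // x _; exact: cst_continuous.
split=> [x _|a]; first exact: cst_continuous.
split=> [x _|]; first exact: derivable_cst.
suff -> : (fun x : 'rV[R]_n => 'D_(delta_mx 0 a) (fun=> c) x) = (fun=> 0).
  exact: IH.
by apply/funext => x; rewrite derive_cst.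
Qed.

Lemma CkD (R : realType) n k (U : set 'rV[R]_n) f g : open U ->
  Ck k U f -> Ck k U g -> Ck k U (fun x => f x + g x).
Proof.
move=> oU; elim: k f g => [|k IH] f g /= [cf df] [cg dg].
  by split=> // x Ux; exact: (continuousD (cf _ Ux) (cg _ Ux)).
split=> [x Ux|a]; first exact: (continuousD (cf _ Ux) (cg _ Ux)).
have [df1 df2] := df a; have [dg1 dg2] := dg a; split=> [x Ux|].
  by apply: derivableD; auto.
apply: Ck_eq (IH _ _ df2 dg2) => // x Ux.
by rewrite deriveD; auto.
Qed.

Lemma CkM (R : realType) n k (U : set 'rV[R]_n) f g : open U ->
  Ck k U f -> Ck k U g -> Ck k U (fun x => f x * g x).
Proof.
move=> oU; elim: k f g => [|k IH] f g.
  by move=> [cf _] [cg _]; split=> // x Ux; exact: (continuousM (cf _ Ux) (cg _ Ux)).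
(* The Leibniz rule multiplies a derivative by an undifferentiated factor, so the induction
   hypothesis needs [f] and [g] themselves at the lower order. *)
move=> Cf Cg; have Cf' := Ck_pred Cf; have Cg' := Ck_pred Cg.
move: Cf Cg => [cf df] [cg dg].
split=> [x Ux|a]; first exact: (continuousM (cf _ Ux) (cg _ Ux)).
have [df1 df2] := df a; have [dg1 dg2] := dg a; split=> [x Ux|].
  by apply: derivableM; auto.
apply: Ck_eq (CkD oU (IH _ _ Cf' dg2) (IH _ _ Cg' df2)) => // x Ux.
by rewrite deriveM; auto.
Qed.

Lemma CkN (R : realType) n k (U : set 'rV[R]_n) f : open U ->
  Ck k U f -> Ck k U (fun x => - f x).
Proof.
move=> oU Cf; apply: Ck_eq (CkM oU (Ck_cst _ U (-1)) Cf) => // x _.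
by rewrite mulN1r.
Qed.

Lemma CkV (R : realType) n k (U : set 'rV[R]_n) f : open U ->
  (forall x, U x -> f x != 0) -> Ck k U f -> Ck k U (fun x => (f x)^-1).
Proof.
move=> oU f0; elim: k => [|k IH].
  by move=> [cf _]; split=> // x Ux; exact: (continuousV (f0 _ Ux) (cf _ Ux)).
move=> Cf; have Cf' := Ck_pred Cf; case: Cf => cf df.
split=> [x Ux|a]; first exact: (continuousV (f0 _ Ux) (cf _ Ux)).
have [df1 df2] := df a; split=> [x Ux|].
  by apply: derivableV; auto.
have CV := IH Cf'.
apply: Ck_eq (CkN oU (CkM oU (CkM oU CV CV) df2)) => // x Ux.
by rewrite deriveV; auto; rewrite -mulNr; congr (- _ * _); rewrite -expr2 exprVn.
Qed.

(** A directional derivative only sees the line through [x] along [v]; on it the one-variable chain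
    rule applies to [g t = f (t *: v + x)]. *)
Lemma is_derive_sqrt (R : realType) (V : normedModType R) (f : V -> R) (x v : V) :
  0 < f x -> derivable f x v ->
  is_derive x v (fun y => Num.sqrt (f y)) ('D_v f x / (2 * Num.sqrt (f x))).
Proof.
move=> f0 df.
pose g t := f (t *: v + x).
have g0 : g 0 = f x by rewrite /g scale0r add0r.
have dg : derivable g 0 1 by exact: (derivable1P f x v).1 df.
have gD : 'D_1 g 0 = 'D_v f x.
  rewrite /derive; congr (lim (_ @ 0^')); apply/funext => h.
  by rewrite /= /g /= addr0 scale0r add0r [h%:A]mulr1.
have s : is_derive (0 : R) 1 (Num.sqrt \o g) ('D_v f x / (2 * Num.sqrt (f x))).
  rewrite -g0 -gD; apply: is_derive_eq.
    apply: is_derive1_comp; first by apply: is_derive1_sqrt; rewrite g0.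
    exact: derivableP.
  by rewrite mulrC.
case: s => s1 s2; split; first exact: (derivable1P _ x v).2 s1.
rewrite -s2 /derive; congr (lim (_ @ 0^')); apply/funext => h.
by rewrite /= /g /= addr0 scale0r add0r [h%:A]mulr1.
Qed.

(** The derivative of the root is the derivative of [f] over twice the root, so order k of the root
    yields order k+1, as for the inverse. *)
Lemma Ck_sqrt (R : realType) n k (U : set 'rV[R]_n) f : open U ->
  (forall x, U x -> 0 < f x) -> Ck k U f -> Ck k U (fun x => Num.sqrt (f x)).
Proof.
move=> oU f0.
have cs x : {for x, continuous f} -> {for x, continuous (fun x => Num.sqrt (f x))}.
  by move=> cf; apply: continuous_comp => //; exact: sqrt_continuous.
elim: k => [|k IH].
  by move=> [cf _]; split=> // x Ux; apply: cs; exact: cf.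
move=> Cf; have Cf' := Ck_pred Cf; case: Cf => cf df.
split=> [x Ux|a]; first by apply: cs; exact: cf.
have [df1 df2] := df a; split=> [x Ux|].
  by have [] := is_derive_sqrt (f0 _ Ux) (df1 _ Ux).
have CS := CkM oU (Ck_cst k U 2) (IH Cf').
have CV := CkV oU _ CS.
apply: Ck_eq (CkM oU df2 (CV _)) => // x Ux.
  by have [_ ->] := is_derive_sqrt (f0 _ Ux) (df1 _ Ux).
by rewrite mulf_neq0 // sqrtr_eq0 -ltNge f0.
Qed.

(** * Charts and products *)

(** The fragment of the atlas conditions that calculus in a single chart relies on. It is
    established separately for the stereographic charts and passes to products. *)
Definition chart_axiom (R : realType) n (M : charted_space R n) (i : idx M) :=
  open (co i @` dom i) /\ forall p, dom i p -> par i (co i p) = p.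

Section Charts.
Context (R : realType) (n : nat) (M : charted_space R n).
Implicit Types (i : idx M) (p : M) (f g : M -> R) (a : 'I_n).

Definition chart_derivable i a f p :=
  derivable (f \o par i) (co i p) (delta_mx 0 a).

Lemma smooth_manifold_chart i : smooth_manifold M -> chart_axiom i.
Proof. by move=> [_ _ _ /(_ i) [_ oi pK _ _] _]; split. Qed.

Lemma par_dom i x : chart_axiom i -> (co i @` dom i) x -> dom i (par i x).
Proof. by move=> [_ pK] [p dp <-]; rewrite pK. Qed.

Lemma near_chart i f g p : chart_axiom i -> dom i p ->
  (forall q, dom i q -> f q = g q) ->
  \forall x \near co i p, (f \o par i) x = (g \o par i) x.
Proof.
move=> ci dp fg; near=> x; apply: fg; apply: par_dom => //.
by near: x; apply: open_nbhs_nbhs; split; [exact: ci.1|exists p].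
Unshelve. all: by end_near. Qed.

Lemma pd_eq i a f g p : chart_axiom i -> dom i p ->
  (forall q, dom i q -> f q = g q) -> pd i a f p = pd i a g p.
Proof. by move=> ci dp fg; apply: near_eq_derive; exact: near_chart. Qed.

Lemma chart_derivable_eq i a f g p : chart_axiom i -> dom i p ->
  (forall q, dom i q -> f q = g q) ->
  chart_derivable i a f p -> chart_derivable i a g p.
Proof. by move=> ci dp fg; apply: near_eq_derivable; exact: near_chart. Qed.

Lemma smooth_chart_derivable i a f p :
  smooth_on (co i @` dom i) (f \o par i) -> dom i p -> chart_derivable i a f p.
Proof. by move=> /(_ 1%N) [_ /(_ a) [df _]] dp; apply: df; exists p. Qed.

Lemma pd_cst i a (c : R) p : pd i a (fun=> c) p = 0.
Proof. exact: derive_cst. Qed.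

Lemma pdM i a f g p : chart_axiom i -> dom i p ->
  chart_derivable i a f p -> chart_derivable i a g p ->
  pd i a (fun q => f q * g q) p = f p * pd i a g p + g p * pd i a f p.
Proof.
move=> [_ pK] dp df dg; rewrite /pd [LHS](deriveM df dg) /=.
by rewrite !pK.
Qed.

Lemma pdD i a f g p :
  chart_derivable i a f p -> chart_derivable i a g p ->
  pd i a (fun q => f q + g q) p = pd i a f p + pd i a g p.
Proof. by move=> df dg; rewrite /pd [LHS](deriveD df dg). Qed.

Lemma pdN i a f p : chart_derivable i a f p ->
  pd i a (fun q => - f q) p = - pd i a f p.
Proof. by move=> df; rewrite /pd [LHS](deriveN df). Qed.

Lemma pdZ i a (c : R) f p : chart_derivable i a f p ->
  pd i a (fun q => c * f q) p = c * pd i a f p.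
Proof. by move=> df; rewrite /pd [LHS](deriveZ c df). Qed.

Lemma pdZr i a (c : R) f p : chart_derivable i a f p ->
  pd i a (fun q => f q * c) p = pd i a f p * c.
Proof.
move=> df; rewrite mulrC -pdZ //; congr (pd i a _ p); apply/funext => q.
exact: mulrC.
Qed.

Lemma chart_derivableM i a f g p :
  chart_derivable i a f p -> chart_derivable i a g p ->
  chart_derivable i a (fun q => f q * g q) p.
Proof. by move=> df dg; exact: (derivableM df dg). Qed.

Lemma chart_derivableZ i a (c : R) f p :
  chart_derivable i a f p -> chart_derivable i a (fun q => c * f q) p.
Proof. by move=> df; exact: (chart_derivableM (derivable_cst c _ _) df). Qed.

Lemma chart_derivableV i a f p : chart_axiom i -> dom i p -> f p != 0 ->
  chart_derivable i a f p -> chart_derivable i a (fun q => (f q)^-1) p.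
Proof.
by move=> [_ pK] dp f0 df; apply: (derivableV _ df); rewrite /= pK.
Qed.

Lemma pdV i a f p : chart_axiom i -> dom i p -> f p != 0 ->
  chart_derivable i a f p ->
  pd i a (fun q => (f q)^-1) p = - (f p) ^- 2 * pd i a f p.
Proof.
move=> [_ pK] dp f0 df; rewrite /pd [LHS](deriveV _ df) /= ?pK //.
Qed.

End Charts.

Section Products.
Context (R : realType) (m n : nat) (M : charted_space R m) (N : charted_space R n).
Implicit Types (i : idx (prod_space M N)) (p : prod_space M N).

Lemma prod_chart_axiom i : chart_axiom i.1 -> chart_axiom i.2 -> chart_axiom i.
Proof.
move=> [U1 pK1] [U2 pK2]; split=> [|[x y] [/= d1 d2]]; last first.
  by rewrite row_mxKl row_mxKr pK1 // pK2.
have -> : co i @` dom i =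
    lsubmx @^-1` (co i.1 @` dom i.1) `&` rsubmx @^-1` (co i.2 @` dom i.2).
  apply/seteqP; split=> [_ [[x y] [/= d1 d2] <-]|z [[x d1 xE] [y d2 yE]]].
    by split; rewrite /= ?row_mxKl ?row_mxKr; [exists x|exists y].
  by exists (x, y) => //=; rewrite xE yE hsubmxK.
apply: openI; apply: open_comp => //= z _.
  exact: continuous_lsubmx.
exact: continuous_rsubmx.
Qed.

Lemma row_line_l (h : R) A (u : 'rV[R]_m) (v : 'rV[R]_n) :
  h *: delta_mx 0 (lshift n A) + row_mx u v = row_mx (h *: delta_mx 0 A + u) v.
Proof. by rewrite delta_mx_lshift scale_row_mx add_row_mx scaler0 add0r. Qed.

Lemma row_line_r (h : R) A (u : 'rV[R]_m) (v : 'rV[R]_n) :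
  h *: delta_mx 0 (rshift m A) + row_mx u v = row_mx u (h *: delta_mx 0 A + v).
Proof. by rewrite delta_mx_rshift scale_row_mx add_row_mx scaler0 add0r. Qed.

(** The coordinate line in a direction of the first factor leaves the second coordinates fixed, so
    the two difference quotients are the same function. *)
Lemma pd_prod_l i A f p : par i.2 (co i.2 p.2) = p.2 ->
  pd i (lshift n A) f p = pd i.1 A (fun x => f (x, p.2)) p.1.
Proof.
move=> pK; rewrite /pd /derive; congr (lim (_ @ 0^')); apply/funext => h /=.
by rewrite row_line_l !row_mxKl !row_mxKr pK.
Qed.

Lemma pd_prod_r i A f p : par i.1 (co i.1 p.1) = p.1 ->
  pd i (rshift m A) f p = pd i.2 A (fun y => f (p.1, y)) p.2.
Proof.
move=> pK; rewrite /pd /derive; congr (lim (_ @ 0^')); apply/funext => h /=.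
by rewrite row_line_r !row_mxKl !row_mxKr pK.
Qed.

Lemma chart_derivable_prod_l i A f p : par i.2 (co i.2 p.2) = p.2 ->
  chart_derivable i (lshift n A) f p <->
  chart_derivable i.1 A (fun x => f (x, p.2)) p.1.
Proof.
move=> pK; rewrite /chart_derivable /derivable.
suff -> : (fun h => h^-1 *: ((f \o par i \o shift (co i p))
      (h *: delta_mx 0 (lshift n A)) - (f \o par i) (co i p))) =
    (fun h => h^-1 *: (((fun x => f (x, p.2)) \o par i.1 \o shift (co i.1 p.1))
      (h *: delta_mx 0 A) - ((fun x => f (x, p.2)) \o par i.1) (co i.1 p.1))).
  by [].
by apply/funext => h /=; rewrite row_line_l !row_mxKl !row_mxKr pK.
Qed.

(** For a function pulled back from the first factor, the partial derivatives along that factor are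
    again pullbacks, and those along the second factor vanish. *)
Lemma Ck_lsubmx k (U : set 'rV[R]_m) (V : set 'rV[R]_(m + n)) f :
  (forall x, V x -> U (lsubmx x)) -> Ck k U f -> Ck k V (f \o lsubmx).
Proof.
move=> VU; elim: k f => [|k IH] f [cf df].
  split=> // x /VU Ux; apply: continuous_comp; last exact: cf.
  exact: continuous_lsubmx.
split=> [x /VU Ux|a].
  by apply: continuous_comp; [exact: continuous_lsubmx|exact: cf].
have row_l h A (x : 'rV[R]_(m + n)) :
    lsubmx (h *: delta_mx 0 (lshift n A) + x) = h *: delta_mx 0 A + lsubmx x.
  by rewrite -[x]hsubmxK row_line_l !row_mxKl.
have row_r h A (x : 'rV[R]_(m + n)) :
    lsubmx (h *: delta_mx 0 (rshift m A) + x) = lsubmx x.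
  by rewrite -[x]hsubmxK row_line_r !row_mxKl.
case: (split_ordP a) => A ->.
  have E x : (fun h => h^-1 *: ((f \o lsubmx \o shift x)
        (h *: delta_mx 0 (lshift n A)) - (f \o lsubmx) x)) =
      (fun h => h^-1 *: ((f \o shift (lsubmx x)) (h *: delta_mx 0 A) -
         f (lsubmx x))).
    by apply/funext => h /=; rewrite row_l.
  have [d1 d2] := df A; split=> [x /VU Ux|].
    by rewrite /derivable E; exact: d1.
  suff -> : (fun x => 'D_(delta_mx 0 (lshift n A)) (f \o lsubmx) x) =
            (fun y => 'D_(delta_mx 0 A) f y) \o lsubmx by exact: IH.
  by apply/funext => x; rewrite /derive E.
have E x : (fun h => h^-1 *: ((f \o lsubmx \o shift x)
      (h *: delta_mx 0 (rshift m A)) - (f \o lsubmx) x)) = (fun h => h^-1 *: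
      (((cst 0 : 'rV[R]_(m + n) -> R) \o shift x)
      (h *: delta_mx 0 (rshift m A)) - (cst 0 : 'rV[R]_(m + n) -> R) x)).
  by apply/funext => h /=; rewrite row_r !subrr.
split=> [x _|].
  by rewrite /derivable E; exact: derivable_cst.
suff -> : (fun x => 'D_(delta_mx 0 (rshift m A)) (f \o lsubmx) x) = (fun=> 0).
  exact: Ck_cst.
by apply/funext => x; rewrite /derive E; exact: derive_cst.
Qed.

End Products.

(** * Functions with vanishing partial derivatives on a connected manifold *)

Lemma locally_constant (T : topologicalType) (S : Type) (f : T -> S) :
  connected [set: T] -> (forall x, \forall y \near x, f y = f x) ->
  forall x y, f y = f x.
Proof.
move=> cT lf x y.
(* Any condition on the value of [f] cuts out an open set. Used for a value and for its negation,
   this makes the level set of [f x] clopen, hence everything. *)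
have open_level (P : S -> Prop) : open [set z | P (f z)].
  rewrite openE => z Pz; rewrite /interior.
  by apply: filterS (lf z) => w /= ->.
suff /seteqP [_ /(_ y I)] : [set z | f z = f x] = setT by [].
apply: cT; first by exists x.
  by exists [set z | f z = f x]; [exact: (open_level (fun s => s = f x))|rewrite setTI].
exists [set z | f z = f x]; last by rewrite setTI.
rewrite -openC; exact: (open_level (fun s => s <> f x)).
Qed.

Lemma line_constant (R : realType) (f : R -> R) (t : R) : 0 <= t ->
  (forall s, 0 <= s <= t -> is_derive s 1 f 0) -> f t = f 0.
Proof.
move=> t0 df.
have [s||c _] := @MVT_segment R f (fun=> 0) 0 t t0.
- by rewrite in_itv /= => /andP[s0 st]; apply: df; rewrite !ltW.
- apply: (derivable_within_continuous (i := `[0, t])) => s.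
  by rewrite in_itv /= => /df [].
by rewrite mul0r => /eqP; rewrite subr_eq0 => /eqP.
Qed.

(** Only derivatives along the axes are given, so [x] is joined to [y] by changing one coordinate at
    a time. Balls are taken entrywise, that is, they are cubes, and the path stays inside. *)
Lemma ball_constant (R : realType) n (f : 'rV[R]_n -> R) (x : 'rV[R]_n) (e : R) :
  (forall (y : 'rV[R]_n) (a : 'I_n), ball x e y -> is_derive y (delta_mx 0 a) f 0) ->
  forall y, ball x e y -> f y = f x.
Proof.
move=> df y xy; have e0 : 0 < e by case: xy.
have step (z : 'rV[R]_n) (a : 'I_n) (t : R) : 0 <= t -> ball x e z ->
    ball x e (t *: delta_mx 0 a + z) -> f (t *: delta_mx 0 a + z) = f z.
  move=> t0 [_ xz] [_ xzt].
  rewrite -{2}[z]add0r -(scale0r (delta_mx 0 a)).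
  apply: (@line_constant _ (fun s => f (s *: delta_mx 0 a + z)) t t0).
  move=> s /andP[s0 st].
  have : ball x e (s *: delta_mx 0 a + z).
    split=> // i j; move: (xz i j) (xzt i j); rewrite !mxE /ball /=.
    case: (_ && _); last by rewrite !mulr0 !add0r.
    by rewrite !mulr1 !ltr_norml => /andP[? ?] /andP[? ?]; apply/andP; split; lra.
  move=> /(df _ a) [D1 D2].
  have E : (fun h : R => h^-1 *: (((fun s => f (s *: delta_mx 0 a + z)) \o shift s)
        (h *: (1 : R)) - f (s *: delta_mx 0 a + z))) =
      (fun h => h^-1 *: ((f \o shift (s *: delta_mx 0 a + z))
        (h *: delta_mx 0 a) - f (s *: delta_mx 0 a + z))).
    by apply/funext => h /=; rewrite [h%:A]mulr1 scalerDl addrA.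
  by split; rewrite /derivable /derive E.
(* The corners of the path: the first [k] coordinates are already those of [y]. *)
pose w k : 'rV[R]_n := \row_j (if (j < k)%N then y 0 j else x 0 j).
have w_ball k : ball x e (w k).
  split=> // i j; rewrite ord1 mxE; case: ifP => _; first by case: xy.
  exact: ballxx.
have -> : y = w n by apply/rowP => j; rewrite mxE ltn_ord.
have -> : x = w 0%N by apply/rowP => j; rewrite mxE.
elim: {-2}n (leqnn n) => // k IH kn; rewrite -(IH (ltnW kn)).
pose a := Ordinal kn; pose t := y 0 a - x 0 a.
have wS : w k.+1 = t *: delta_mx 0 a + w k.
  apply/rowP => j; rewrite !mxE eqxx /= ltnS leq_eqVlt -(inj_eq val_inj) /=.
  have [jk|jk] := eqVneq (val j) k; last by rewrite mulr0 add0r.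
  have -> : j = a by apply/val_inj.
  by rewrite /= ltnn mulr1 subrK.
(* [step] covers nonnegative displacements; a negative one is traversed backwards, from [w k.+1] to
   [w k]. *)
have [t0|t0] := leP 0 t.
  by rewrite wS step // -wS.
have wk : w k = (- t) *: delta_mx 0 a + w k.+1.
  by rewrite wS addrA -scalerDl addNr scale0r add0r.
by rewrite [in RHS]wk step // -?wk // oppr_ge0 ltW.
Qed.

Lemma pd0_constant (R : realType) n (M : charted_space R n) (f : M -> R) :
  smooth_manifold M -> connected [set: M] ->
  (forall i p a, dom i p -> chart_derivable i a f p /\ pd i a f p = 0) ->
  forall x y, f y = f x.
Proof.
move=> mM cM df; apply: locally_constant => // x.
have [_ _ /(_ x) [i dx] /(_ i) [Ud oi pK cc _] _] := mM.
have ci := smooth_manifold_chart i mM.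
have /nbhs_ballP [e e0 be] : nbhs (co i x) (co i @` dom i).
  by apply: open_nbhs_nbhs; split=> //; exists x.
have fe := @ball_constant R n (f \o par i) (co i x) e.
near=> y.
have dy : dom i y by near: y; apply: open_nbhs_nbhs; split.
rewrite -(pK _ dy) -[in RHS](pK _ dx); apply: fe.
  move=> z a /be [q dq <-]; have [? ?] := df i q a dq; exact: DeriveDef.
by near: y; apply: (cc _ dx); exact: nbhsx_ballx.
Unshelve. all: by end_near. Qed.

(** * The round sphere in stereographic coordinates *)

Lemma ord2E : (lift ord0 ord0 = 1 :> 'I_2) * (ord_max = 1 :> 'I_2).
Proof. by split; apply/val_inj. Qed.

Lemma big_ord2 (R : nmodType) (F : 'I_2 -> R) : \sum_k F k = F 0 + F 1.
Proof. by rewrite !big_ord_recl big_ord0 addr0 ord2E. Qed.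

Lemma ord2_case (P : 'I_2 -> Prop) : P 0 -> P 1 -> forall i, P i.
Proof.
move=> P0 P1 [[|[|//]] k].
  by rewrite (_ : Ordinal k = 0) //; apply/val_inj.
by rewrite (_ : Ordinal k = 1) //; apply/val_inj.
Qed.

Lemma det_mx2 (R : comRingType) (A : 'M[R]_2) :
  \det A = A 0 0 * A 1 1 - A 0 1 * A 1 0.
Proof.
rewrite (expand_det_row _ 0) big_ord2 /cofactor !det_mx11 !mxE /=.
have -> : lift 0 0 = 1 :> 'I_2 by apply/val_inj.
have -> : lift 1 0 = 0 :> 'I_2 by apply/val_inj.
by rewrite expr0 expr1 mul1r mulN1r mulrN.
Qed.

Lemma is_derive_linear (R : realType) (V : normedModType R) (f : V -> R) x v :
  (forall h y z, f (h *: y + z) = h * f y + f z) -> is_derive x v f (f v).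
Proof.
move=> lf.
pose q (h : R) := h^-1 *: ((f \o shift x) (h *: v) - f x).
have qE : \forall h \near (0 : R)^', f v = q h.
  near=> h; rewrite /q /= lf addrK /GRing.scale /= mulKf //.
  by near: h; exact: nbhs_dnbhs_neq.
have H : q h @[h --> (0 : R)^'] --> f v.
  apply: cvg_trans (@cvg_cst _ _ _ (0 : R)^' (dnbhs_filter _)).
  exact: (@near_eq_cvg _ _ (0 : R)^' _ (fun=> f v) q qE).
by split; [apply: cvgP H|exact: cvg_lim H].
Unshelve. all: by end_near. Qed.

Section Sphere.
Context (R : realType).
Implicit Types (s : bool) (u : 'rV[R]_2) (x : S2 R) (i : 'I_2).

Lemma is_derive_coord n (u : 'rV[R]_n) (k i : 'I_n) :
  is_derive u (delta_mx 0 i) (fun v : 'rV[R]_n => v 0 k) (k == i)%:R.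
Proof.
have := @is_derive_linear R _ (fun v : 'rV[R]_n => v 0 k) u (delta_mx 0 i).
by rewrite mxE eqxx; apply=> h y z; rewrite !mxE.
Qed.

Definition sqn u := u 0 0 ^+ 2 + u 0 1 ^+ 2.

Lemma sqn_ge0 u : 0 <= sqn u.
Proof. by rewrite addr_ge0 ?sqr_ge0. Qed.

Lemma sqn1_neq0 u : sqn u + 1 != 0.
Proof. by rewrite lt0r_neq0 // ltr_wpDl ?sqn_ge0. Qed.

Lemma is_derive_sqn u i : is_derive u (delta_mx 0 i) sqn (2 * u 0 i).
Proof.
have d k := is_derive_coord u k i.
apply: (is_derive_eq (is_deriveD (is_deriveX 2 (d 0)) (is_deriveX 2 (d 1)))).
rewrite /GRing.scale /= !expr1; elim/ord2_case: i {d}.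
  by rewrite mulr1 mulr0 addr0.
by rewrite mulr1 mulr0 add0r.
Qed.

(** All coordinates of the inverse stereographic projection have the denominator [sqn u + 1], so
    this quotient rule gives every tangent vector. *)
Lemma is_derive_div_sqn u i (f : 'rV[R]_2 -> R) df :
  is_derive u (delta_mx 0 i) f df ->
  is_derive u (delta_mx 0 i) (fun v => f v / (sqn v + 1))
    ((df * (sqn u + 1) - f u * (2 * u 0 i)) / (sqn u + 1) ^+ 2).
Proof.
move=> fE; have m0 := sqn1_neq0 u.
have dm := is_deriveD (is_derive_sqn u i) (is_derive_cst (1 : R) u (delta_mx 0 i)).
have dV : is_derive u (delta_mx 0 i) (fun v => (sqn v + 1)^-1)
    (- (sqn u + 1) ^- 2 *: (2 * u 0 i + 0)).
  case: dm => dm1 dm2; split; first exact: derivableV.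
  by rewrite deriveV // [X in _ *: X]dm2.
apply: (is_derive_eq (is_deriveM fE dV)).
by rewrite /GRing.scale /=; field.
Qed.

Lemma stereo_inv_coord s u :
  [/\ stereo_inv s u 0 0 = 2 * u 0 0 / (sqn u + 1),
      stereo_inv s u 0 1 = 2 * u 0 1 / (sqn u + 1) &
      stereo_inv s u 0 ord_max = (-1) ^+ s * (sqn u - 1) / (sqn u + 1)].
Proof. by split; rewrite !mxE big_ord2. Qed.

Lemma ord3_case (P : 'I_3 -> Prop) : P 0 -> P 1 -> P ord_max -> forall j, P j.
Proof.
move=> P0 P1 P2 [[|[|[|//]]] k].
- by rewrite (_ : Ordinal k = 0) //; apply/val_inj.
- by rewrite (_ : Ordinal k = 1) //; apply/val_inj.
- by rewrite (_ : Ordinal k = ord_max) //; apply/val_inj.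
Qed.

(** The inverse projection is defined on the whole plane and never reaches the pole, so the chart
    image is the plane; the rest is the algebra of two mutually inverse maps. *)
Lemma sphere_chart_axiom (s : idx (S2 R)) : chart_axiom s.
Proof.
have parK u : stereo s (stereo_inv s u) = u.
  have m0 := sqn1_neq0 u; have [e0 e1 e2] := stereo_inv_coord s u.
  have d : 1 - (-1) ^+ s * stereo_inv s u 0 ord_max = 2 / (sqn u + 1).
    by rewrite e2 !mulrA -expr2 sqrr_sign; field.
  apply/rowP => k; rewrite mxE d.
  elim/ord2_case: k.
    by rewrite (_ : widen_ord _ _ = 0) ?e0; [field|apply/val_inj].
  by rewrite (_ : widen_ord _ _ = 1) ?e1; [field|apply/val_inj].
split.
  suff -> : co s @` dom s = setT by exact: openT.
  apply/seteqP; split=> // u _; exists (par s u); last exact: parK.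
  have m0 := sqn1_neq0 u; have [_ _ e2] := stereo_inv_coord s u.
  apply/eqP; rewrite /= e2 => e.
  (* What reaching the pole would mean for the last coordinate. *)
  have {e} : sqn u - 1 = sqn u + 1.
    have := congr1 (fun t => (-1) ^+ s * t) e.
    by rewrite !mulrA -!expr2 sqrr_sign mul1r => /(canRL (divfK m0)); rewrite mul1r.
  by move=> /addrI /eqP; rewrite -subr_eq0; apply/negP; rewrite lt_eqF //; lra.
move=> x; rewrite /= => dx; apply/val_inj => /=.
have sx : \sum_(k < 3) sval x 0 k ^+ 2 = 1 by have := valP x; rewrite inE.
have [e0 e1 e2] := stereo_inv_coord s (stereo s (sval x)).
move: (sval x) sx dx e0 e1 e2 => w sw dw.
have w3 : w 0 0 ^+ 2 + w 0 1 ^+ 2 + w 0 ord_max ^+ 2 = 1.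
  rewrite -[RHS]sw !big_ord_recl big_ord0 addr0 addrA.
  by congr (_ + _ ^+ 2 + _ ^+ 2); congr (w 0 _); apply/val_inj.
have d0 : 1 - (-1) ^+ s * w 0 ord_max != 0.
  apply: contra dw; rewrite subr_eq0 => /eqP /(congr1 (fun t => (-1) ^+ s * t)).
  by rewrite mulrA -expr2 sqrr_sign mul1r mulr1 => ->.
have c0 : stereo s w 0 0 = w 0 0 / (1 - (-1) ^+ s * w 0 ord_max).
  by rewrite mxE; congr (w 0 _ / _); apply/val_inj.
have c1 : stereo s w 0 1 = w 0 1 / (1 - (-1) ^+ s * w 0 ord_max).
  by rewrite mxE; congr (w 0 _ / _); apply/val_inj.
have s2 : ((-1) ^+ s : R) ^+ 2 = 1 by rewrite sqrr_sign.
set t : R := (-1) ^+ s in d0 c0 c1 s2 *.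
(* Here |w| = 1 and t^2 = 1 enter: together they give w_0^2 + w_1^2 + (1 - t w_2)^2 = 2 (1 - t
   w_2). *)
have q1 : sqn (stereo s w) + 1 = 2 / (1 - t * w 0 ord_max).
  rewrite /sqn c0 c1; apply: (mulIf (expf_neq0 2 d0)).
  transitivity (w 0 0 ^+ 2 + w 0 1 ^+ 2 + (1 - t * w 0 ord_max) ^+ 2).
    by field.
  transitivity (2 * (1 - t * w 0 ord_max)); last by field.
  have -> : (1 - t * w 0 ord_max) ^+ 2 =
      1 - 2 * (t * w 0 ord_max) + t ^+ 2 * w 0 ord_max ^+ 2 by ring.
  by rewrite s2 mul1r; move: w3; lra.
have q0 : sqn (stereo s w) - 1 = 2 * t * w 0 ord_max / (1 - t * w 0 ord_max).
  by rewrite (_ : _ - 1 = sqn (stereo s w) + 1 - 2); [rewrite q1; field|ring].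
move=> e0 e1 e2; apply/rowP => k; elim/ord3_case: k.
- by rewrite e0 q1 c0; field.
- by rewrite e1 q1 c1; field.
rewrite e2 q1 q0; transitivity (t ^+ 2 * w 0 ord_max); first by field.
by rewrite s2 mul1r.
Qed.

Lemma tangentE (s : idx (S2 R)) i x (u := co s x) :
  [/\ tangent s i x 0 0 =
        (2 * (0 == i)%:R * (sqn u + 1) - 2 * u 0 0 * (2 * u 0 i)) / (sqn u + 1) ^+ 2,
      tangent s i x 0 1 =
        (2 * (1 == i)%:R * (sqn u + 1) - 2 * u 0 1 * (2 * u 0 i)) / (sqn u + 1) ^+ 2 &
      tangent s i x 0 ord_max = (-1) ^+ s * (4 * u 0 i) / (sqn u + 1) ^+ 2].
Proof.
have tE k : tangent s i x 0 k =
    'D_(delta_mx 0 i) (fun v => stereo_inv s v 0 k) u.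
  by rewrite mxE.
have dc k := is_deriveZ 2 (is_derive_coord u k i).
have dm := is_deriveZ ((-1) ^+ s)
  (is_deriveB (is_derive_sqn u i) (is_derive_cst (1 : R) u (delta_mx 0 i))).
have tD k (f : 'rV[R]_2 -> R) df : (forall v, stereo_inv s v 0 k = f v) ->
    is_derive u (delta_mx 0 i) f df -> tangent s i x 0 k = df.
  by move=> fE [_ <-]; rewrite tE; have -> : f = fun v => stereo_inv s v 0 k
    by apply/funext => v; rewrite fE.
have E v := stereo_inv_coord s v.
split.
- by apply: tD (is_derive_div_sqn (dc 0)) => v; have [] := E v.
- by apply: tD (is_derive_div_sqn (dc 1)) => v; have [] := E v.
have fE v : stereo_inv s v 0 ord_max =
    ((-1) ^+ s \*: (sqn - cst 1)) v / (sqn v + 1) by have [] := E v.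
rewrite (tD _ _ _ fE (is_derive_div_sqn dm)).
rewrite [X in _ - X * _](_ : _ = (-1) ^+ s * (sqn u - 1)) //.
have m0 := sqn1_neq0 u.
by rewrite /GRing.scale /=; field.
Qed.

Lemma big_ord3 (F : 'I_3 -> R) : \sum_k F k = F 0 + F 1 + F ord_max.
Proof.
rewrite !big_ord_recl big_ord0 addr0 addrA.
by congr (_ + F _ + F _); apply/val_inj.
Qed.

(** Stereographic projection is conformal, with factor 4 / (|u|^2 + 1)^2. Symmetry, invertibility
    and nonzero diagonal entries of the sphere block all follow from this form. *)
Lemma sphere_metric_scalar (s : idx (S2 R)) x :
  exists2 c : R, c != 0 & sphere_metric s x = c%:M.
Proof.
have m0 := sqn1_neq0 (co s x).
exists (4 / (sqn (co s x) + 1) ^+ 2).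
  by rewrite mulf_neq0 // invr_neq0 // expf_neq0.
apply/matrixP => i j; rewrite [LHS]mxE [RHS]mxE big_ord3.
have [i0 i1 i2] := tangentE s i x; have [j0 j1 j2] := tangentE s j x.
apply: etrans (congr2 +%R (congr2 +%R (congr2 *%R i0 j0) (congr2 *%R i1 j1))
  (congr2 *%R i2 j2)) _.
clear i0 i1 i2 j0 j1 j2.
have s2 : ((-1) ^+ s : R) ^+ 2 = 1 by rewrite sqrr_sign.
move: m0 s2; rewrite /sqn; set t : R := (-1) ^+ s.
set a := co s x 0 0; set b := co s x 0 1 => m0 s2.
(* The sign of the chart occurs only squared, in the product of the third components. *)
have -> : t * (4 * co s x 0 i) / (a ^+ 2 + b ^+ 2 + 1) ^+ 2 *
  (t * (4 * co s x 0 j) / (a ^+ 2 + b ^+ 2 + 1) ^+ 2) =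
  t ^+ 2 * (16 * co s x 0 i * co s x 0 j / (a ^+ 2 + b ^+ 2 + 1) ^+ 4) by field.
rewrite s2.
by elim/ord2_case: i; elim/ord2_case: j; rewrite /= -/a -/b; field.
Qed.

(** [Q2] does not depend on the point of the sphere, so a single point with nonzero area form is
    enough to detect its vanishing. *)
Lemma sphere_vol_neq0 : exists (s : idx (S2 R)) x,
  dom s x /\ sphere_vol s x 0 1 != 0 :> R.
Proof.
(* The centre of this chart is (0, 0, -1), with tangent vectors (2, 0, 0) and (0, 2, 0); the
   determinant is -4. *)
exists false, (par (false : idx (S2 R)) 0).
set x := par _ _; have [_ xE] := sphere_chart_axiom (false : idx (S2 R)).
have q0 : sqn (0 : 'rV[R]_2) = 0 by rewrite /sqn !mxE expr0n addr0.
have [x0 x1 x2] := stereo_inv_coord false (0 : 'rV[R]_2).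
have {}x0 : stereo_inv false (0 : 'rV[R]_2) 0 0 = 0 by rewrite x0 mxE; ring.
have {}x1 : stereo_inv false (0 : 'rV[R]_2) 0 1 = 0 by rewrite x1 mxE; ring.
have {}x2 : stereo_inv false (0 : 'rV[R]_2) 0 ord_max = -1.
  by rewrite x2 q0 expr0 !add0r divr1 mul1r.
have dx : dom (false : idx (S2 R)) x.
  by rewrite /= x2 expr0 lt_eqF //; lra.
split=> //.
have c0 : co (false : idx (S2 R)) x = 0.
  apply/rowP => k; rewrite /= mxE x2 mxE.
  by elim/ord2_case: k; rewrite /= !mxE mulr0 !mul0r.
have [t00 t01 t02] := tangentE (false : idx (S2 R)) 0 x.
have [t10 t11 t12] := tangentE (false : idx (S2 R)) 1 x.
rewrite /sphere_vol mxE.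
set t0 := tangent _ 0 x in t00 t01 t02 *.
set t1 := tangent _ 1 x in t10 t11 t12 *.
pose A : 'M[R]_3 := col_mx (val x : 'rV[R]_3) (col_mx t0 t1).
rewrite -/A.
have A0 k : A 0 k = stereo_inv false 0 0 k.
  rewrite (_ : 0 = lshift 2 (ord0 : 'I_1) :> 'I_3); last exact/val_inj.
  by rewrite /A (@col_mxEu _ 1 2).
have A1 k : A (lift 0 0) k = t0 0 k.
  rewrite (_ : lift 0 0 = rshift 1 (lshift 1 (ord0 : 'I_1)) :> 'I_3).
    by rewrite /A (@col_mxEd _ 1 2) (@col_mxEu _ 1 1).
  exact/val_inj.
have A2 k : A (lift 0 1) k = t1 0 k.
  rewrite (_ : lift 0 1 = rshift 1 (rshift 1 (ord0 : 'I_1)) :> 'I_3).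
    by rewrite /A (@col_mxEd _ 1 2) (@col_mxEd _ 1 1).
  exact/val_inj.
clearbody A t0 t1.
rewrite (expand_det_row _ 0) big_ord3 !A0 x0 x1 x2.
rewrite !mul0r !add0r /cofactor det_mx2 !mxE.
have -> : lift (ord_max : 'I_3) 0 = 0 by apply/val_inj.
have -> : lift (ord_max : 'I_3) 1 = 1 by apply/val_inj.
rewrite !A1 !A2 t00 t01 t10 t11 c0 q0 !mxE /=.
rewrite [X in X != 0](_ : _ = -4); last by field.
by rewrite oppr_eq0 pnatr_eq0.
Qed.
End Sphere.

(** * Closed conformal Killing-Yano forms *)

Section Torsion.
Context (R : realType) (n : nat) (M : charted_space R n).
Context (g Y : tensor2 M) (i : idx M) (p : M).
Hypothesis ci : chart_axiom i.
Hypothesis dp : dom i p.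
Hypothesis gT : forall q, dom i q -> (g i q)^T = g i q.
Hypothesis YT : (Y i p)^T = - Y i p.

Lemma metric_sym q a b : dom i q -> g i q a b = g i q b a.
Proof. by move=> /gT /matrixP /(_ b a); rewrite mxE. Qed.

Lemma form_antisym a b : Y i p a b = - Y i p b a.
Proof. by have /matrixP /(_ b a) := YT; rewrite !mxE. Qed.

Lemma christoffel_sym a b c : christoffel g i a b c p = christoffel g i a c b p.
Proof.
rewrite /christoffel; congr (_ * _); apply: eq_bigr => d _.
have -> : pd i d (fun q => g i q b c) p = pd i d (fun q => g i q c b) p.
  by apply: pd_eq => // q dq; exact: metric_sym.
by congr (_ * (_ - _)); rewrite addrC.
Qed.

(* The Christoffel symbols are symmetric in the lower indices, so they drop out
   of the cyclic sum. *)
Lemma nabla2_cyclic a b c :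
  nabla2 g Y i c a b p + nabla2 g Y i a b c p + nabla2 g Y i b c a p =
  pd i a (fun q => Y i q b c) p + pd i b (fun q => Y i q c a) p
  + pd i c (fun q => Y i q a b) p.
Proof.
have cancel x y z : \sum_d christoffel g i d x y p * Y i p d z =
    - \sum_d christoffel g i d y x p * Y i p z d.
  rewrite -sumrN; apply: eq_bigr => d _.
  by rewrite christoffel_sym form_antisym mulrN.
rewrite /nabla2 (cancel c a b) (cancel a b c) (cancel b c a).
set A := pd _ _ _ _; set B := pd _ _ _ _; set C := pd _ _ _ _.
set u := \sum_d _; set v := \sum_d _; set w := \sum_d _; ring.
Qed.

(** Contracting the equation with the inverse metric gives n xi_a - xi_a on the right, which the
    normalization 1/(n - 1) turns into xi_a. Hence a solution [xi] of the equation without [z] is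
    automatically the associated form. *)
Lemma nabla2_assoc_form (xi : 'I_n -> R) :
  g i p \in unitmx -> n%:R - 1 != 0 :> R ->
  (forall a b c, nabla2 g Y i c a b p = g i p c a * xi b - g i p c b * xi a) ->
  forall a, assoc_form g Y i a p = xi a.
Proof.
move=> gU n1 nE a; rewrite /assoc_form.
have gV b d : \sum_c invmx (g i p) b c * g i p c d = (b == d)%:R.
  by have /matrixP /(_ b d) := mulVmx gU; rewrite !mxE.
transitivity ((n%:R - 1)^-1 * \sum_(b < n) (xi a - (b == a)%:R * xi b)).
  congr (_ * _); apply: eq_bigr => b _.
  have b1 : (b == b)%:R = 1 :> R by rewrite eqxx.
  rewrite -gV -[xi a in RHS]mul1r -b1 -gV !mulr_suml -sumrB.
  by apply: eq_bigr => c _; rewrite nE mulrBr !mulrA.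
rewrite sumrB sumr_const card_ord (bigD1 a) //= eqxx mul1r big1 ?addr0.
  by rewrite -[RHS](mulKf n1) mulrBl mul1r mulr_natl.
by move=> b /negPf ->; rewrite mul0r.
Qed.

Lemma nabla2_closed_form2 (xi : 'I_n -> R) :
  (forall a b c, nabla2 g Y i c a b p = g i p c a * xi b - g i p c b * xi a) ->
  forall a b c, pd i a (fun q => Y i q b c) p + pd i b (fun q => Y i q c a) p
    + pd i c (fun q => Y i q a b) p = 0.
Proof.
move=> nE a b c; rewrite -nabla2_cyclic !nE.
by rewrite (metric_sym b a) // (metric_sym c b) // (metric_sym c a) //; ring.
Qed.

End Torsion.

(** In the cyclic sum of the CKY equation the metric terms cancel by symmetry and [z] appears three
    times; the sum is the exterior derivative, so closedness forces [z] to vanish. *)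
Lemma closed_CKY_nabla2 (R : realType) n (M : charted_space R n)
    (g Y : tensor2 M) i p : chart_axiom i -> dom i p ->
  (forall q, dom i q -> (g i q)^T = g i q) -> closed_CKY g Y ->
  forall a b c, nabla2 g Y i c a b p =
    g i p c a * assoc_form g Y i b p - g i p c b * assoc_form g Y i a p.
Proof.
move=> ci dp gT [[[_ YT] [z zE]] cY] a b c.
have sym d e : g i p d e = g i p e d by exact: metric_sym.
have := nabla2_cyclic ci dp gT (YT _ _ dp) a b c.
rewrite cY //.
have [z1 z2 ->] := zE i p dp a b c.
have [z3 z4 ->] := zE i p dp b c a.
have [z5 z6 ->] := zE i p dp c a b.
have -> : z i p b c a = z i p a b c by rewrite -[LHS]opprK -z4 z1 opprK.
have -> : z i p c a b = z i p a b c by rewrite -[LHS]opprK -z5 z2 opprK.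
rewrite (sym b a) (sym c b) (sym c a) => e.
have cyc (u v w xa xb xc t : R) : u * xb - v * xa + t + (w * xc - u * xb + t)
    + (v * xa - w * xc + t) = 3 * t by ring.
move: e; rewrite cyc => /eqP; rewrite mulf_eq0 pnatr_eq0 /= => /eqP ->.
by rewrite addr0.
Qed.

(** * The connection of a spherically symmetric metric *)

Section SphericalConnection.
Context (R : realType) (M2 : charted_space R 2) (h : tensor2 M2) (r : M2 -> R).
Local Notation M := (prod_space M2 (S2 R)).
Local Notation G := (spherical_metric h r).
Local Notation l := (@lshift 2 2).
Local Notation s := (@rshift 2 2).
Context (i : idx M) (p : M).
Hypothesis c1 : chart_axiom i.1.
Hypothesis dp : dom i p.
Hypothesis hT : forall x, dom i.1 x -> (h i.1 x)^T = h i.1 x.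
Hypothesis hU : h i.1 p.1 \in unitmx.
Hypothesis dr : forall A, chart_derivable i.1 A r p.1.
Hypothesis r0 : r p.1 != 0.

Local Notation gam := (sphere_metric i.2 p.2).
Local Notation hV := (invmx (h i.1 p.1)).

Let pK1 : par i.1 (co i.1 p.1) = p.1.
Proof. by apply: c1.2; case: dp. Qed.

Let pK2 : par i.2 (co i.2 p.2) = p.2.
Proof. by apply: (sphere_chart_axiom i.2).2; case: dp. Qed.

Let ci : chart_axiom i := prod_chart_axiom c1 (sphere_chart_axiom i.2).

Lemma spherical_metric_ll q A B : G i q (l A) (l B) = h i.1 q.1 A B.
Proof. by rewrite /spherical_metric block_mxEul. Qed.

Lemma spherical_metric_ls q A j : G i q (l A) (s j) = 0.
Proof. by rewrite /spherical_metric block_mxEur mxE. Qed.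

Lemma spherical_metric_sl q j A : G i q (s j) (l A) = 0.
Proof. by rewrite /spherical_metric block_mxEdl mxE. Qed.

Lemma spherical_metric_ss q j k :
  G i q (s j) (s k) = r q.1 ^+ 2 * sphere_metric i.2 q.2 j k.
Proof. by rewrite /spherical_metric block_mxEdr mxE. Qed.

Lemma spherical_metric_tr q : dom i q -> (G i q)^T = G i q.
Proof.
move=> [d1 d2]; rewrite /spherical_metric tr_block_mx !trmx0 hT // linearZ /=.
by have [c _ ->] := sphere_metric_scalar i.2 q.2; rewrite tr_scalar_mx.
Qed.

Lemma sphere_metric_unit : gam \in unitmx.
Proof.
have [c c0 ->] := sphere_metric_scalar i.2 p.2.
by rewrite unitmxE det_scalar unitfE expf_neq0.
Qed.

Lemma spherical_metric_unit : G i p \in unitmx.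
Proof.
rewrite block_diag_mx_unit hU unitmxZ ?sphere_metric_unit //.
by rewrite unitfE expf_neq0.
Qed.

Lemma invmx_spherical_metric :
  invmx (G i p) = block_mx hV 0 0 ((r p.1 ^+ 2)^-1 *: invmx gam).
Proof.
rewrite invmx_block_diag ?spherical_metric_unit // invmxZ //.
by rewrite unitmxZ ?sphere_metric_unit // unitfE expf_neq0.
Qed.

Lemma dG_l_ll C A B : pd i (l C) (fun q => G i q (l A) (l B)) p =
  pd i.1 C (fun x => h i.1 x A B) p.1.
Proof.
rewrite pd_prod_l //.
suff -> : (fun x => G i (x, p.2) (l A) (l B)) = (fun x => h i.1 x A B) by [].
by apply/funext => x; exact: spherical_metric_ll.
Qed.

Lemma dG_s_ll k A B : pd i (s k) (fun q => G i q (l A) (l B)) p = 0.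
Proof.
rewrite pd_prod_r //.
suff -> : (fun y => G i (p.1, y) (l A) (l B)) = (fun=> h i.1 p.1 A B).
  exact: pd_cst.
by apply/funext => x; exact: spherical_metric_ll.
Qed.

Lemma dG_ls c A j : pd i c (fun q => G i q (l A) (s j)) p = 0.
Proof.
suff -> : (fun q => G i q (l A) (s j)) = (fun=> 0) by exact: pd_cst.
by apply/funext => x; exact: spherical_metric_ls.
Qed.

Lemma dG_sl c j A : pd i c (fun q => G i q (s j) (l A)) p = 0.
Proof.
suff -> : (fun q => G i q (s j) (l A)) = (fun=> 0) by exact: pd_cst.
by apply/funext => x; exact: spherical_metric_sl.
Qed.

Lemma dG_l_ss C j k : pd i (l C) (fun q => G i q (s j) (s k)) p =
  2 * r p.1 * pd i.1 C r p.1 * gam j k.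
Proof.
have dp1 : dom i.1 p.1 by case: dp.
rewrite pd_prod_l //.
have -> : (fun x => G i (x, p.2) (s j) (s k)) = (fun x => r x * r x * gam j k).
  by apply/funext => x; rewrite spherical_metric_ss expr2.
rewrite pdZr; last exact: chart_derivableM.
by rewrite pdM //; ring.
Qed.

Lemma big_split22 (F : 'I_(2 + 2) -> R) :
  \sum_d F d = \sum_D F (l D) + \sum_k F (s k).
Proof. exact: big_split_ord. Qed.

Lemma christoffel_lll A B C :
  christoffel G i (l A) (l B) (l C) p = christoffel h i.1 A B C p.1.
Proof.
rewrite /christoffel big_split22 invmx_spherical_metric [X in _ + X]big1 ?addr0.
  by congr (_ * _); apply: eq_bigr => D _; rewrite !dG_l_ll block_mxEul.
by move=> k _; rewrite block_mxEur mxE mul0r.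
Qed.

Lemma christoffel_lls A B k : christoffel G i (l A) (l B) (s k) p = 0.
Proof.
rewrite /christoffel big_split22.
rewrite [X in X + _]big1; last first.
  move=> D _.
  rewrite (dG_ls (l B)).
  rewrite (dG_ls (l D)).
  by rewrite dG_s_ll add0r subr0 mulr0.
rewrite [X in _ + X]big1.
  by rewrite addr0 mulr0.
move=> j _; rewrite invmx_spherical_metric block_mxEur mxE mul0r.
by [].
Qed.

Lemma christoffel_lsl A k B : christoffel G i (l A) (s k) (l B) p = 0.
Proof.
rewrite christoffel_sym ?christoffel_lls //.
by move=> q; exact: spherical_metric_tr.
Qed.

Definition grad_r A := \sum_B hV A B * pd i.1 B r p.1.

Lemma christoffel_lss A j k :
  christoffel G i (l A) (s j) (s k) p = - r p.1 * gam j k * grad_r A.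
Proof.
rewrite /christoffel big_split22 invmx_spherical_metric [X in _ + X]big1 ?addr0.
  rewrite /grad_r !mulr_sumr; apply: eq_bigr => D _.
  by rewrite !dG_ls dG_l_ss block_mxEul; field.
by move=> m _; rewrite block_mxEur mxE mul0r.
Qed.

Lemma christoffel_sls j A k :
  christoffel G i (s j) (l A) (s k) p = pd i.1 A r p.1 / r p.1 * (j == k)%:R.
Proof.
rewrite /christoffel big_split22 invmx_spherical_metric [X in X + _]big1 ?add0r.
  have /matrixP /(_ j k) := mulVmx sphere_metric_unit; rewrite !mxE => <-.
  rewrite !mulr_sumr; apply: eq_bigr => m _.
  by rewrite dG_l_ss dG_sl dG_ls block_mxEdr mxE; field.
by move=> D _; rewrite block_mxEdl mxE mul0r.
Qed.

(** * Covariant derivatives of block-diagonal 2-forms *)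

Section Forms.
Context (Y : tensor2 M).

(** The sphere block of [Y] is left arbitrary, since this is what later shows that it vanishes. The
    mixed symbols are diagonal in the sphere indices, whence one factor dr/r per index. *)
Lemma nabla2_lss C j k :
  (forall q A m, dom i q -> Y i q (l A) (s m) = 0) ->
  (forall q m A, dom i q -> Y i q (s m) (l A) = 0) ->
  nabla2 G Y i (l C) (s j) (s k) p =
  pd i (l C) (fun q => Y i q (s j) (s k)) p
  - 2 * (pd i.1 C r p.1 / r p.1) * Y i p (s j) (s k).
Proof.
move=> Yls Ysl; rewrite /nabla2 !big_split22.
rewrite [X in _ - (X + _) - _]big1 ?add0r; last by move=> D _; rewrite Yls ?mulr0.
rewrite [X in _ - _ - (X + _)]big1 ?add0r; last by move=> D _; rewrite Ysl ?mulr0.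
have E k' (F : 'I_2 -> R) : \sum_m christoffel G i (s m) (l C) (s k') p * F m =
    pd i.1 C r p.1 / r p.1 * F k'.
  rewrite (bigD1 k') //= christoffel_sls eqxx mulr1 big1 ?addr0 // => m /negPf mk.
  by rewrite christoffel_sls mk mulr0 mul0r.
by rewrite (E j (fun m => Y i p (s m) (s k))) (E k (fun m => Y i p (s j) (s m))); ring.
Qed.

(* [jmx A B = B - A] is the Levi-Civita symbol. *)
Definition jmx : 'M[R]_2 := \matrix_(A, B) ((B : nat)%:R - (A : nat)%:R).

Lemma jmxC A B : jmx A B = - jmx B A.
Proof. by rewrite !mxE opprB. Qed.

Context (W : M2 -> R).
Hypothesis YE : forall q, dom i q ->
  Y i q = block_mx (W q.1 *: jmx) 0 0 0.
Hypothesis dW : forall A, chart_derivable i.1 A W p.1.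

Let Yll q A B : dom i q -> Y i q (l A) (l B) = W q.1 * jmx A B.
Proof. by move=> dq; rewrite YE // block_mxEul mxE. Qed.

Let Yls q A j : dom i q -> Y i q (l A) (s j) = 0.
Proof. by move=> dq; rewrite YE // block_mxEur !mxE. Qed.

Let Ysl q j A : dom i q -> Y i q (s j) (l A) = 0.
Proof. by move=> dq; rewrite YE // block_mxEdl !mxE. Qed.

Let Yss q j k : dom i q -> Y i q (s j) (s k) = 0.
Proof. by move=> dq; rewrite YE // block_mxEdr !mxE. Qed.

Let pd0 c a b : (forall q, dom i q -> Y i q a b = 0) ->
  pd i c (fun q => Y i q a b) p = 0.
Proof. by move=> E; rewrite (pd_eq c ci dp E) pd_cst. Qed.

(** [W] is the coefficient with respect to the Levi-Civita symbol, so it contains the density of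
    [h]. In two dimensions a matrix acting on both indices of the symbol multiplies it by its trace,
    here the trace of the Christoffel symbols. *)
Lemma nabla2_lll C A B : nabla2 G Y i (l C) (l A) (l B) p =
  (pd i.1 C W p.1 - W p.1 * \sum_D christoffel h i.1 D C D p.1) * jmx A B.
Proof.
have -> : nabla2 G Y i (l C) (l A) (l B) p =
    pd i.1 C W p.1 * jmx A B
    - \sum_D christoffel h i.1 D C A p.1 * (W p.1 * jmx D B)
    - \sum_D christoffel h i.1 D C B p.1 * (W p.1 * jmx A D).
  rewrite /nabla2 !big_split22; congr (_ - _ - _).
  - have E q : dom i q -> Y i q (l A) (l B) = W q.1 * jmx A B.
      exact: Yll.
    by rewrite (pd_eq _ ci dp E) pd_prod_l // pdZr.
  - rewrite [X in _ + X]big1 ?addr0; last by move=> m _; rewrite Ysl ?mulr0.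
    by apply: eq_bigr => D _; rewrite christoffel_lll Yll //.
  - rewrite [X in _ + X]big1 ?addr0; last by move=> m _; rewrite Yls ?mulr0.
    by apply: eq_bigr => D _; rewrite christoffel_lll Yll //.
rewrite !big_ord2 !mxE.
by elim/ord2_case: A; elim/ord2_case: B; rewrite /=; ring.
Qed.

Lemma nabla2_lls C A k : nabla2 G Y i (l C) (l A) (s k) p = 0.
Proof.
rewrite /nabla2 !big_split22 pd0; last by move=> q; exact: Yls.
rewrite !big1 ?addr0 ?subr0 //.
- by move=> m _; rewrite Yls ?mulr0.
- by move=> m _; rewrite christoffel_lls mul0r.
- by move=> m _; rewrite Yss ?mulr0.
- by move=> m _; rewrite Yls ?mulr0.
Qed.

Lemma nabla2_lsl C k A : nabla2 G Y i (l C) (s k) (l A) p = 0.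
Proof.
rewrite /nabla2 !big_split22 pd0; last by move=> q; exact: Ysl.
rewrite !big1 ?addr0 ?subr0 //.
- by move=> m _; rewrite Yss ?mulr0.
- by move=> m _; rewrite Ysl ?mulr0.
- by move=> m _; rewrite Ysl ?mulr0.
- by move=> m _; rewrite christoffel_lls mul0r.
Qed.

Lemma nabla2_sll k A B : nabla2 G Y i (s k) (l A) (l B) p = 0.
Proof.
have E q : dom i q -> Y i q (l A) (l B) = W q.1 * jmx A B.
  exact: Yll.
have dY : pd i (s k) (fun q => Y i q (l A) (l B)) p = 0.
  rewrite (pd_eq _ ci dp E) pd_prod_r //.
  exact: (pd_cst i.2 k (W p.1 * jmx A B) p.2).
rewrite /nabla2 !big_split22 dY.
rewrite !big1 ?addr0 ?subr0 //.
- by move=> m _; rewrite Yls ?mulr0.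
- by move=> m _; rewrite christoffel_lsl mul0r.
- by move=> m _; rewrite Ysl ?mulr0.
- by move=> m _; rewrite christoffel_lsl mul0r.
Qed.

(** [Y] has no mixed or sphere components, so only the term with Gamma^D_kj survives: the bending of
    the spheres in the direction of the gradient of [r]. *)
Lemma nabla2_sls k A j : nabla2 G Y i (s k) (l A) (s j) p =
  r p.1 * gam k j * W p.1 * \sum_D jmx A D * grad_r D.
Proof.
rewrite /nabla2 !big_split22 pd0; last by move=> q; exact: Yls.
rewrite [X in _ - (X + _) - _]big1; last by move=> m _; rewrite Yls ?mulr0.
rewrite [X in _ - (_ + X) - _]big1; last by move=> m _; rewrite Yss ?mulr0.
rewrite [X in _ - _ - (_ + X)]big1; last by move=> m _; rewrite Yls ?mulr0.
rewrite !addr0 !sub0r oppr0 add0r -sumrN mulr_sumr; apply: eq_bigr => D _.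
by rewrite christoffel_lss Yll //; ring.
Qed.

Lemma nabla2_ssl k j A : nabla2 G Y i (s k) (s j) (l A) p =
  - (r p.1 * gam k j * W p.1 * \sum_D jmx A D * grad_r D).
Proof.
rewrite /nabla2 !big_split22 pd0; last by move=> q; exact: Ysl.
rewrite [X in _ - _ - (X + _)]big1; last by move=> m _; rewrite Ysl ?mulr0.
rewrite [X in _ - _ - (_ + X)]big1; last by move=> m _; rewrite Yss ?mulr0.
rewrite [X in _ - (_ + X) - _]big1; last by move=> m _; rewrite Ysl ?mulr0.
rewrite !addr0 !sub0r subr0 mulr_sumr -!sumrN; apply: eq_bigr => D _.
by rewrite christoffel_lss Yll // (jmxC D); ring.
Qed.

Lemma nabla2_sss k j m : nabla2 G Y i (s k) (s j) (s m) p = 0.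
Proof.
rewrite /nabla2 !big_split22 pd0; last by move=> q; exact: Yss.
rewrite !big1 ?addr0 ?subr0 //.
- by move=> D _; rewrite Yss ?mulr0.
- by move=> D _; rewrite Ysl ?mulr0.
- by move=> D _; rewrite Yss ?mulr0.
- by move=> D _; rewrite Yls ?mulr0.
Qed.

Lemma nabla2_lss0 C j k : nabla2 G Y i (l C) (s j) (s k) p = 0.
Proof.
rewrite (nabla2_lss _ _ _ Yls Ysl) pd0 => [|q]; last exact: Yss.
by rewrite Yss // mulr0 subr0.
Qed.

End Forms.
End SphericalConnection.

(** * The volume form of a Lorentzian surface *)

(** Taking determinants in the diagonalization gives det(P)^2 det(h) = -1. *)
Lemma lorentzian_det_lt0 (R : realType) (M2 : charted_space R 2) (h : tensor2 M2)
    i x : lorentzian h -> dom i x -> \det (h i x) < 0.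
Proof.
move=> [_ hL] dx; have [P PU PE] := hL i x dx.
have P0 : \det P != 0 by rewrite -unitfE -unitmxE.
have /(congr1 determinant) := PE; rewrite !det_mulmx det_tr det_diag.
rewrite !big_ord_recl big_ord0 !mxE /= expr1 expr0 !mulr1 => e.
have : \det P ^+ 2 * \det (h i x) < 0.
  by rewrite expr2 mulrAC e; lra.
by rewrite pmulr_rlt0 // exprn_even_gt0.
Qed.

Lemma pd_mulB_mul (R : realType) n (M : charted_space R n) i C x (a b c d : M -> R) :
  chart_axiom i -> dom i x ->
  chart_derivable i C a x -> chart_derivable i C b x ->
  chart_derivable i C c x -> chart_derivable i C d x ->
  pd i C (fun y => a y * b y - c y * d y) x =
  a x * pd i C b x + b x * pd i C a x - (c x * pd i C d x + d x * pd i C c x).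
Proof.
move=> ci dx da db dc dd.
have dab := chart_derivableM da db; have dcd := chart_derivableM dc dd.
by rewrite (pdD dab (derivableN dcd)) (pdN dcd) !pdM.
Qed.

Section Volume.
Context (R : realType) (M2 : charted_space R 2) (h : tensor2 M2).
Hypothesis mM : smooth_manifold M2.
Hypothesis hL : lorentzian h.

Definition density i x := Num.sqrt `|\det (h i x)|.

Lemma volE i x : vol h i x = density i x *: jmx R.
Proof. by apply/matrixP => A B; rewrite !mxE. Qed.

Lemma density_gt0 i x : dom i x -> 0 < density i x.
Proof.
by move=> dx; rewrite sqrtr_gt0 normr_gt0 ltr0_neq0 ?lorentzian_det_lt0.
Qed.

(** This is - det h, positive in Lorentzian signature; the density is its square root, which removes
    the absolute value before differentiating. *)
Let mdet i x := h i x 0 1 * h i x 1 0 - h i x 0 0 * h i x 1 1.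

Lemma mdet_gt0 i x : dom i x -> 0 < mdet i x.
Proof.
move=> dx; have := lorentzian_det_lt0 hL dx; rewrite det_mx2 /mdet; lra.
Qed.

Lemma densityE i x : dom i x -> density i x = Num.sqrt (mdet i x).
Proof.
move=> dx; rewrite /density ltr0_norm ?lorentzian_det_lt0 //.
by rewrite det_mx2 opprB.
Qed.

Lemma sqr_density i x : dom i x -> density i x * density i x = mdet i x.
Proof. by move=> dx; rewrite densityE // -expr2 sqr_sqrtr // ltW ?mdet_gt0. Qed.

Lemma metric_smooth i A B : smooth_on (co i @` dom i) (fun u => h i (par i u) A B).
Proof. by case: hL => -[[+ _] _] _; exact. Qed.

Lemma metric_tr i x : dom i x -> (h i x)^T = h i x.
Proof. by case: hL => -[_ /(_ i x) H] _ /H []. Qed.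

Lemma metric_unit i x : dom i x -> h i x \in unitmx.
Proof. by case: hL => -[_ /(_ i x) H] _ /H []. Qed.

Lemma density_smooth i :
  smooth_on (co i @` dom i) (fun u => density i (par i u)).
Proof.
have ci := smooth_manifold_chart i mM; have oU := ci.1.
move=> k; have hk A B := metric_smooth i A B k.
apply: (@Ck_eq _ _ _ _ (fun u => Num.sqrt (mdet i (par i u)))) => //.
  by move=> u /(par_dom ci) du; rewrite densityE.
apply: Ck_sqrt => // [u /(par_dom ci) du|]; first exact: mdet_gt0.
by apply: CkD => //; [|apply: CkN => //]; apply: CkM.
Qed.

Lemma metric_derivable i A B C x : dom i x ->
  chart_derivable i C (fun y => h i y A B) x.
Proof. by apply: smooth_chart_derivable; exact: metric_smooth. Qed.

Lemma density_derivable i C x : dom i x -> chart_derivable i C (density i) x.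
Proof. by apply: smooth_chart_derivable; exact: density_smooth. Qed.

Lemma invmx2 (A : 'M[R]_2) : A \in unitmx ->
  [/\ invmx A 0 0 = A 1 1 / \det A, invmx A 0 1 = - A 0 1 / \det A,
      invmx A 1 0 = - A 1 0 / \det A & invmx A 1 1 = A 0 0 / \det A].
Proof.
move=> AU; have l0 : lift 0 0 = 1 :> 'I_2 by apply/val_inj.
have l1 : lift 1 0 = 0 :> 'I_2 by apply/val_inj.
rewrite /invmx AU; split; rewrite !mxE /cofactor det_mx11 !mxE ?l0 ?l1.
- by rewrite expr0 mul1r mulrC.
- by rewrite expr1 mulN1r mulrC.
- by rewrite expr1 mulN1r mulrC.
- by rewrite sqrrN expr1n mul1r mulrC.
Qed.

(** The classical formula for the derivative of the density, equivalent to [vol h] being parallel.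
    The square of the density is - det h; its derivative is compared with the trace of the
    Christoffel symbols, written with the explicit 2 by 2 inverse. *)
Lemma pd_density i C x : dom i x ->
  pd i C (density i) x = density i x * \sum_D christoffel h i D C D x.
Proof.
move=> dx; have ci := smooth_manifold_chart i mM.
have s0 := density_gt0 dx; have D0 := lorentzian_det_lt0 hL dx.
have dh A B C' : chart_derivable i C' (fun y => h i y A B) x.
  exact: metric_derivable.
have sym y A B : dom i y -> h i y A B = h i y B A.
  by move=> dy; apply: metric_sym => // z; exact: metric_tr.
have dsym A B C' : pd i C' (fun y => h i y A B) x = pd i C' (fun y => h i y B A) x.
  by apply: pd_eq => // y; exact: sym.
have e : 2 * density i x * pd i C (density i) x =
    h i x 0 1 * pd i C (fun y => h i y 1 0) x + h i x 1 0 * pd i C (fun y => h i y 0 1) x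
    - (h i x 0 0 * pd i C (fun y => h i y 1 1) x + h i x 1 1 * pd i C (fun y => h i y 0 0) x).
  have ds : chart_derivable i C (density i) x by exact: density_derivable.
  transitivity (pd i C (fun y => density i y * density i y) x).
    by rewrite pdM //; ring.
  rewrite (pd_eq C ci dx (@sqr_density i)) /mdet.
  exact: (pd_mulB_mul ci dx (dh 0 1 C) (dh 1 0 C) (dh 0 0 C) (dh 1 1 C)).
apply: (mulfI (_ : 2 * density i x != 0)); first by rewrite mulf_neq0 // gt_eqF.
rewrite e; have -> (t : R) : 2 * density i x * (density i x * t) =
    2 * (density i x * density i x) * t by ring.
rewrite sqr_density // /mdet big_ord2 /christoffel !big_ord2.
have [-> -> -> ->] := invmx2 (metric_unit dx).
move: D0; rewrite det_mx2 (sym x 1 0) //.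
move=> /lt_eqF /negbT D0.
clear e s0 dh sym.
elim/ord2_case: C; rewrite ?(dsym 1 0 0) ?(dsym 1 0 1);
  move: (pd i 0 (fun y => h i y 0 0) x) (pd i 1 (fun y => h i y 0 0) x)
        (pd i 0 (fun y => h i y 0 1) x) (pd i 1 (fun y => h i y 0 1) x)
        (pd i 0 (fun y => h i y 1 1) x) (pd i 1 (fun y => h i y 1 1) x)
        (h i x 0 0) (h i x 0 1) (h i x 1 1) D0 => *; by field.
Qed.

(** The density scales by |det J| and the Levi-Civita symbol by det J; the orientation makes the two
    factors agree. *)
Lemma vol_transform i j x : oriented M2 -> dom i x -> dom j x ->
  vol h i x = (jac i j x)^T *m vol h j x *m jac i j x.
Proof.
move=> oM di dj; have J0 := oM i j x di dj; rewrite !volE.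
have hE : h i x = (jac i j x)^T *m h j x *m jac i j x.
  by case: hL => -[[_ H] _] _; exact: H.
have -> : density i x = \det (jac i j x) * density j x.
  rewrite /density hE !det_mulmx det_tr !normrM (gtr0_norm J0) mulrAC -expr2.
  by rewrite sqrtrM ?sqr_ge0 // sqrtr_sqr (gtr0_norm J0).
move: (jac i j x) => J; rewrite det_mx2 -scalemxAr -scalemxAl.
by apply/matrixP => A B; rewrite !mxE !big_ord2 !mxE !big_ord2 !mxE;
  elim/ord2_case: A; elim/ord2_case: B => /=; ring.
Qed.

End Volume.

(** * The Kodama vector field *)

Section Kodama.
Context (R : realType) (M2 : charted_space R 2) (h : tensor2 M2) (r : M2 -> R).
Hypothesis mM : smooth_manifold M2.
Hypothesis hL : lorentzian h.
Hypothesis r_smooth : smooth_fun r.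
Hypothesis r_gt0 : forall x, 0 < r x.

Local Notation M := (prod_space M2 (S2 R)).
Local Notation G := (spherical_metric h r).
Local Notation l := (@lshift 2 2).
Local Notation s := (@rshift 2 2).

Implicit Types (i : idx M) (p : M) (Y : tensor2 M).

Let rn0 x : r x != 0. Proof. by rewrite lt0r_neq0. Qed.

Lemma prod_chart i : chart_axiom i.
Proof.
by apply: prod_chart_axiom; [exact: smooth_manifold_chart|exact: sphere_chart_axiom].
Qed.

Lemma r_derivable (i : idx M2) C x : dom i x -> chart_derivable i C r x.
Proof. by apply: smooth_chart_derivable; exact: r_smooth. Qed.

Lemma r_volE i p : r_vol h r i p =
  block_mx ((r p.1 * density h i.1 p.1) *: jmx R) 0 0 0.
Proof. by rewrite /r_vol volE scalerA. Qed.

Lemma lower_grad_r i p A : dom i p ->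
  h i.1 p.1 A 0 * grad_r h r i p 0 + h i.1 p.1 A 1 * grad_r h r i p 1 =
  pd i.1 A r p.1.
Proof.
move=> [d1 _]; have /matrixP hV := mulmxV (metric_unit hL d1).
rewrite /grad_r !big_ord2.
have := hV A 0; have := hV A 1; rewrite !mxE !big_ord2.
(* The Kronecker deltas are exactly the entries of [h *m invmx h] provided by [hV]. *)
have -> : pd i.1 A r p.1 = (A == 0)%:R * pd i.1 0 r p.1 + (A == 1)%:R * pd i.1 1 r p.1.
  by elim/ord2_case: A => /=; rewrite mul1r mul0r ?addr0 ?add0r.
move: (invmx _) (pd _ 0 _ _) (pd _ 1 _ _) => V r0 r1 <- <-; ring.
Qed.

(** The Kodama field times [c] with its index lowered, - c eps_AD grad^D r, extended by zero along
    the sphere. *)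
Definition kodama_form (c : R) i p : 'rV[R]_(2 + 2) :=
  row_mx (\row_A - (c * density h i.1 p.1 * \sum_D jmx R A D * grad_r h r i p D)) 0.

Lemma kodama_form_l c i p A : kodama_form c i p 0 (l A) =
  - (c * density h i.1 p.1 * \sum_D jmx R A D * grad_r h r i p D).
Proof. by rewrite row_mxEl mxE. Qed.

Lemma kodama_form_s c i p k : kodama_form c i p 0 (s k) = 0.
Proof. by rewrite row_mxEr mxE. Qed.

Section Multiple.
Context (c : R) (Y : tensor2 M) (i : idx M) (p : M).
Hypothesis YE : forall q, dom i q -> Y i q = c *: r_vol h r i q.
Hypothesis dp : dom i p.

(** The multiple [c] is kept general: c = 1 gives existence, and arbitrary c gives the associated
    field of every solution. The eight cases are the block types of the three indices. *)
Lemma nabla2_kodama a b d : nabla2 G Y i d a b p =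
  G i p d a * kodama_form c i p 0 b - G i p d b * kodama_form c i p 0 a.
Proof.
have d1 : dom i.1 p.1 by case: dp.
have c1 := smooth_manifold_chart i.1 mM.
have hU := metric_unit hL d1.
have hT x : dom i.1 x -> (h i.1 x)^T = h i.1 x by exact: metric_tr.
have dr A : chart_derivable i.1 A r p.1 by exact: r_derivable.
have ds A : chart_derivable i.1 A (density h i.1) p.1.
  exact: (density_derivable mM hL).
pose W x := c * (r x * density h i.1 x).
have YW q : dom i q -> Y i q = block_mx (W q.1 *: jmx R) 0 0 0.
  by move=> dq; rewrite YE // r_volE scale_block_mx !scaler0 scalerA.
have drs A := chart_derivableM (dr A) (ds A).
have dW A : chart_derivable i.1 A W p.1 by exact: (chart_derivableZ (drs A)).
(* The derivative of the density cancels the trace of the Christoffel symbols, leaving only the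
   derivative of [r]. *)
have pW A : pd i.1 A W p.1 - W p.1 * \sum_D christoffel h i.1 D A D p.1 =
    c * density h i.1 p.1 * pd i.1 A r p.1.
  by rewrite /W pdZ // pdM // (pd_density mM hL) //; ring.
have r0 := rn0 p.1.
case: (split_ordP d) => D ->; case: (split_ordP a) => A ->;
  case: (split_ordP b) => B ->; rewrite ?kodama_form_l ?kodama_form_s
    ?spherical_metric_ll ?spherical_metric_ls ?spherical_metric_sl
    ?spherical_metric_ss ?mul0r ?mulr0 ?subr0 ?sub0r ?oppr0.
(* Writing dr as the lowered gradient, what remains is the Schouten identity: antisymmetrizing over
   three indices gives zero in dimension two. *)
- rewrite (nabla2_lll c1 dp hU r0 YW dW) pW -(lower_grad_r D dp) !big_ord2.
  rewrite !mxE.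
  by elim/ord2_case: A; elim/ord2_case: B; rewrite /=; ring.
- exact: (nabla2_lls c1 dp hU r0 YW).
- exact: (nabla2_lsl c1 dp hU r0 YW).
- exact: (nabla2_lss0 c1 dp hU dr r0 YW).
- exact: (nabla2_sll c1 dp hT hU r0 YW).
- by rewrite (nabla2_sls c1 dp hU dr r0 YW) /W; ring.
- by rewrite (nabla2_ssl c1 dp hU dr r0 YW) /W; ring.
- exact: (nabla2_sss _ _ c1 dp YW).
Qed.

Lemma assoc_form_kodama a : assoc_form G Y i a p = kodama_form c i p 0 a.
Proof.
have [d1 _] := dp; apply: (nabla2_assoc_form _ _ nabla2_kodama).
  by apply: spherical_metric_unit => //; exact: metric_unit.
by rewrite subr_eq0 pnatr_eq1.
Qed.

Lemma assoc_vector_kodama : assoc_vector G Y i p = c *: kodama_field h r i p.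
Proof.
have [d1 _] := dp; have hU := metric_unit hL d1.
apply/rowP => a; rewrite /assoc_vector mxE [RHS]mxE big_split22.
rewrite invmx_spherical_metric //.
rewrite [X in _ + X]big1 ?addr0; last first.
  by move=> k _; rewrite assoc_form_kodama kodama_form_s mulr0.
case: (split_ordP a) => A ->; last first.
  rewrite row_mxEr mxE mulr0 big1 // => D _.
  by rewrite block_mxEdl mxE mul0r.
(* [vol_up] raises the second index with the transposed inverse, the gradient with the inverse
   itself; symmetry reconciles them. *)
have hV01 : invmx (h i.1 p.1) 1 0 = invmx (h i.1 p.1) 0 1.
  have /matrixP /(_ 0 1) : (invmx (h i.1 p.1))^T = invmx (h i.1 p.1).
    by rewrite trmx_inv (metric_tr hL d1).
  by rewrite mxE.
rewrite row_mxEl /kodama mxE !big_ord2 !block_mxEul !assoc_form_kodama.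
rewrite !kodama_form_l /vol_up volE -scalemxAr -scalemxAl /grad_r !big_ord2.
move: hV01; move: (invmx _) => V V01.
rewrite !mxE !big_ord2 !mxE !big_ord2 !mxE V01.
move: (pd _ 0 _ _) (pd _ 1 _ _) (density _ _ _) => r0 r1 e.
by elim/ord2_case: A; rewrite /= ?V01; ring.
Qed.

End Multiple.
End Kodama.

(** * Existence and uniqueness *)

Lemma jac_prod (R : realType) m n (M : charted_space R m) (N : charted_space R n)
    (i j : idx (prod_space M N)) p :
  chart_axiom i.1 -> chart_axiom i.2 -> dom i p ->
  jac i j p = block_mx (jac i.1 j.1 p.1) 0 0 (jac i.2 j.2 p.2).
Proof.
move=> [_ K1] [_ K2] [d1 d2].
apply/matrixP => c a; rewrite mxE.
case: (split_ordP c) => C ->; case: (split_ordP a) => A ->.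
- rewrite block_mxEul mxE pd_prod_l ?K2 //.
  suff -> : (fun x => co j (x, p.2) 0 (lshift n C)) = (fun x => co j.1 x 0 C) by [].
  by apply/funext => x; rewrite row_mxEl.
- rewrite block_mxEur mxE pd_prod_r ?K1 //.
  suff -> : (fun y => co j (p.1, y) 0 (lshift n C)) = (fun=> co j.1 p.1 0 C).
    exact: pd_cst.
  by apply/funext => x; rewrite row_mxEl.
- rewrite block_mxEdl mxE pd_prod_l ?K2 //.
  suff -> : (fun x => co j (x, p.2) 0 (rshift m C)) = (fun=> co j.2 p.2 0 C).
    exact: pd_cst.
  by apply/funext => x; rewrite row_mxEr.
- rewrite block_mxEdr mxE pd_prod_r ?K1 //.
  suff -> : (fun y => co j (p.1, y) 0 (rshift m C)) = (fun y => co j.2 y 0 C) by [].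
  by apply/funext => x; rewrite row_mxEr.
Qed.

Section ClosedCKY.
Context (R : realType) (M2 : charted_space R 2) (h : tensor2 M2) (r : M2 -> R).
Hypothesis mM : smooth_manifold M2.
Hypothesis hL : lorentzian h.
Hypothesis r_smooth : smooth_fun r.
Hypothesis r_gt0 : forall x, 0 < r x.

Local Notation M := (prod_space M2 (S2 R)).
Local Notation G := (spherical_metric h r).
Local Notation l := (@lshift 2 2).
Local Notation s := (@rshift 2 2).

Implicit Types (i : idx M) (p : M) (Y : tensor2 M).

Let rn0 x : r x != 0. Proof. by rewrite lt0r_neq0. Qed.

Lemma r_vol_symmetric : spherically_symmetric h (r_vol h r).
Proof. by exists r, (fun=> 0) => i p _; rewrite /spherical_form scale0r. Qed.

(** The transformation law reduces to that of [vol h], because the Jacobian of a product is block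
    diagonal. For smoothness, the only nonzero block is pulled back from the surface. *)
Lemma r_vol_tensor2 : oriented M2 -> is_tensor2 (r_vol h r).
Proof.
move=> oM; split=> [i a b|i j p [d1 d2] [e1 e2]]; last first.
  have dp : dom i p by split.
  rewrite (jac_prod j (smooth_manifold_chart i.1 mM) (sphere_chart_axiom i.2) dp).
  rewrite /r_vol (vol_transform hL oM d1 e1) tr_block_mx !trmx0 !mulmx_block.
  rewrite !(mulmx0, mul0mx, addr0, add0r) -?scalemxAr -?scalemxAl.
  by [].
have ci := prod_chart mM i; have c1 := smooth_manifold_chart i.1 mM.
move=> k.
have C0 : Ck k (co i @` dom i) (fun=> 0 : R) by exact: Ck_cst.
pose f (u : 'rV[R]_2) := r (par i.1 u) * density h i.1 (par i.1 u).
have Cf : Ck k (co i @` dom i) (f \o lsubmx).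
  apply: (@Ck_lsubmx _ _ _ _ (co i.1 @` dom i.1)).
    by move=> _ [q [dq _] <-]; exists q.1 => //; rewrite row_mxKl.
  apply: CkM; [exact: c1.1|exact: r_smooth|exact: density_smooth].
have E x : r_vol h r i (par i x) a b = block_mx (f (lsubmx x) *: jmx R) 0 0 0 a b.
  by rewrite r_volE.
case: (split_ordP a) E => A ->; case: (split_ordP b) => B -> E.
- apply: Ck_eq (CkM ci.1 Cf (Ck_cst k _ (jmx R A B))); first exact: ci.1.
  by move=> x _; rewrite E block_mxEul [RHS]mxE.
- apply: Ck_eq C0; first exact: ci.1.
  by move=> x _; rewrite E block_mxEur mxE.
- apply: Ck_eq C0; first exact: ci.1.
  by move=> x _; rewrite E block_mxEdl mxE.
- apply: Ck_eq C0; first exact: ci.1.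
  by move=> x _; rewrite E block_mxEdr mxE.
Qed.

Lemma jmxE : ((jmx R 0 0 = 0) * (jmx R 0 1 = 1)) * ((jmx R 1 0 = -1) * (jmx R 1 1 = 0)).
Proof. by rewrite !mxE /= !subr0 sub0r !subrr. Qed.

Lemma jmx_tr : (jmx R)^T = - jmx R.
Proof. by apply/matrixP => A B; rewrite !mxE opprB. Qed.

Lemma r_vol_tr i p : (r_vol h r i p)^T = - r_vol h r i p.
Proof.
rewrite r_volE tr_block_mx !trmx0 opp_block_mx !oppr0.
by rewrite linearZ /= jmx_tr scalerN.
Qed.

Lemma r_vol_closed_CKY : oriented M2 -> closed_CKY G (r_vol h r).
Proof.
move=> oM.
have YE i q : dom i q -> r_vol h r i q = 1 *: r_vol h r i q by rewrite scale1r.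
have nE i p (dp : dom i p) := nabla2_kodama mM hL r_smooth r_gt0 (YE i) dp.
split; last first.
  move=> i p dp a b c.
  have GT q : dom i q -> (G i q)^T = G i q.
    by apply: spherical_metric_tr => x; exact: metric_tr.
  exact: (nabla2_closed_form2 (prod_chart mM i) dp GT (r_vol_tr i p)
    (xi := fun a => kodama_form h r 1 i p 0 a) (nE i p dp)).
split; first by split; [exact: r_vol_tensor2|move=> i p _; exact: r_vol_tr].
exists (fun _ _ _ _ _ => 0) => i p dp a b c.
split; rewrite ?oppr0 // addr0 (nE i p dp).
by rewrite !(assoc_form_kodama mM hL r_smooth r_gt0 (YE i) dp).
Qed.

(** * Uniqueness up to a constant factor *)

Section Uniqueness.
Context (Y : tensor2 M) (Q1 Q2 : M2 -> R).
Hypothesis dr0 : forall (i : idx M2) x, dom i x -> exists A : 'I_2, pd i A r x != 0.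
Hypothesis YQ : forall i p, dom i p -> Y i p = spherical_form h Q1 Q2 i p.
Hypothesis cY : closed_CKY G Y.

Let hT (i : idx M) x : dom i.1 x -> (h i.1 x)^T = h i.1 x.
Proof. exact: metric_tr. Qed.

Let GT i q : dom i q -> (G i q)^T = G i q.
Proof. by apply: spherical_metric_tr; exact: hT. Qed.

Let nE i p (dp : dom i p) := closed_CKY_nabla2 (prod_chart mM i) dp (@GT i) cY.

(* dY = 0 makes Q2 constant, while the CKY equation makes Q2 / r^2 constant. *)
Lemma sphere_part_eq0 x : Q2 x = 0.
Proof.
have [_ _ /(_ x) [j dx] _ _] := mM.
have [k [y [dy w0]]] := sphere_vol_neq0 R.
pose i : idx M := (j, k); pose p : M := (x, y).
have dp : dom i p by [].
have ci := prod_chart mM i; have c1 := smooth_manifold_chart j mM.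
have [C rC] := dr0 dx.
have Yls q A m : dom i q -> Y i q (l A) (s m) = 0.
  by move=> dq; rewrite YQ // block_mxEur mxE.
have Ysl q m A : dom i q -> Y i q (s m) (l A) = 0.
  by move=> dq; rewrite YQ // block_mxEdl mxE.
(* The other two terms of the closedness equation differentiate mixed components, which vanish
   identically. *)
have dY : pd i (l C) (fun q => Y i q (s 0) (s 1)) p = 0.
  have := cY.2 i p dp (l C) (s 0) (s 1).
  rewrite (pd_eq _ ci dp (fun q => Ysl q 1 C)) (pd_eq _ ci dp (fun q => Yls q C 0)).
  by rewrite !pd_cst !addr0.
have dr A : chart_derivable j A r x by exact: r_derivable.
have := nE dp (s 0) (s 1) (l C).
rewrite !spherical_metric_ls !mul0r subr0.
rewrite (nabla2_lss (i := i) (p := p) c1 dp (metric_unit hL dx) dr (rn0 x) C 0 1 Yls Ysl).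
rewrite dY sub0r => /eqP; rewrite oppr_eq0 !mulf_eq0 pnatr_eq0 invr_eq0.
rewrite (negPf rC) (negPf (rn0 x)) /= YQ // block_mxEdr mxE mulf_eq0.
by rewrite (negPf w0) orbF => /eqP.
Qed.

Let W (i : idx M2) x := Q1 x * density h i x.

Let YW i p : dom i p -> Y i p = block_mx (W i.1 p.1 *: jmx R) 0 0 0.
Proof.
by move=> dp; rewrite YQ // /spherical_form sphere_part_eq0 scale0r volE scalerA.
Qed.

(** Differentiability is known for the components of [Y] and not directly for [Q1], so the ratio is
    handled as [W i] divided by [r] times the density. *)
Lemma ratio_derivative (i : idx M2) x C : dom i x ->
  chart_derivable i C (fun y => Q1 y / r y) x /\ pd i C (fun y => Q1 y / r y) x = 0.
Proof.
move=> dx.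
have [k [y [dy _]]] := sphere_vol_neq0 R.
pose j : idx M := (i, k); pose p : M := (x, y).
have dp : dom j p by [].
have cj := prod_chart mM j; have c1 := smooth_manifold_chart i mM.
have dW A : chart_derivable i A (W i) x.
  have : chart_derivable j (l A) (fun q => Y j q (l 0) (l 1)) p.
    by apply: smooth_chart_derivable => //; exact: cY.1.1.1.1.
  have E q : dom j q -> Y j q (l 0) (l 1) = W i q.1.
    by move=> dq; rewrite YW // block_mxEul !mxE subr0 mulr1.
  move=> /(chart_derivable_eq cj dp E) /chart_derivable_prod_l; apply.
  exact: (sphere_chart_axiom k).2.
have dr A : chart_derivable i A r x by exact: r_derivable.
have ds : chart_derivable i C (density h i) x by exact: density_derivable.
have hU := metric_unit hL dx.
have s0 := density_gt0 hL dx.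
have YWj q : dom j q -> Y j q = block_mx (W i q.1 *: jmx R) 0 0 0 by exact: YW.
pose T := \sum_D christoffel h i D C D x.
(* After division by the density this reads r dQ1 = Q1 dr. *)
have key : r x * (pd i C (W i) x - W i x * T) = W i x * pd i C r x.
  have [c c0 gE] := sphere_metric_scalar k y.
  (* Obtained from one diagonal sphere component, whose metric coefficient [c] is nonzero and can be
     cancelled together with one factor [r x]. *)
  have xiE A : r x * assoc_form G Y j (l A) p =
      - (W i x * \sum_D jmx R A D * grad_r h r j p D).
    have := nE dp (l A) (s 0) (s 0).
    rewrite (nabla2_sls (i := j) (p := p) c1 dp hU dr (rn0 x) YWj) spherical_metric_sl mul0r sub0r.
    rewrite spherical_metric_ss /= gE mxE eqxx mulr1n => e.
    apply: (mulfI c0); apply: (mulfI (rn0 x)).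
    transitivity (- (- (r x ^+ 2 * c * assoc_form G Y j (l A) p))); first by ring.
    by rewrite -e; ring.
  have := nE dp (l 0) (l 1) (l C).
  rewrite (nabla2_lll (i := j) (p := p) c1 dp hU (rn0 x) YWj dW) !spherical_metric_ll /= -/T => e.
  have := lower_grad_r r hL C dp; rewrite /= => <-.
  move: (xiE 0) (xiE 1) e; rewrite !big_ord2 !jmxE mulr1.
  move: (assoc_form _ _ _ (l 0) _) (assoc_form _ _ _ (l 1) _) => xi0 xi1 e0 e1.
  move: (pd i C (W i) x - _) => D ->.
  transitivity (h i x C 0 * (r x * xi1) - h i x C 1 * (r x * xi0)); first by ring.
  by rewrite e0 e1; ring.
have drs := chart_derivableM (dr C) ds.
have rs0 : r x * density h i x != 0 by rewrite mulf_neq0 // gt_eqF.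
have dV := chart_derivableV c1 dx rs0 drs.
have E y' : dom i y' -> W i y' * (r y' * density h i y')^-1 = Q1 y' / r y'.
  by move=> dy'; have := density_gt0 hL dy'; rewrite /W => /lt0r_neq0 ?; field; rewrite rn0.
split; first exact: (chart_derivable_eq c1 dx E (chart_derivableM (dW C) dV)).
rewrite -(pd_eq C c1 dx E) (pdM c1 dx (dW C) dV) (pdV c1 dx rs0 drs).
rewrite (pdM c1 dx (dr C) ds) (pd_density mM hL) // -/T.
have -> : W i x * (- (r x * density h i x) ^- 2 *
    (r x * (density h i x * T) + density h i x * pd i C r x)) +
    (r x * density h i x)^-1 * pd i C (W i) x =
  density h i x * (r x * (pd i C (W i) x - W i x * T) - W i x * pd i C r x)
    / (r x * density h i x) ^+ 2.
  have := rn0 x; have := lt0r_neq0 s0.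
  move: (pd _ _ _ _) (pd _ _ _ _) (W i x) (r x) (density _ _ _) => *.
  by field; apply/andP.
by rewrite key subrr mulr0 mul0r.
Qed.

Lemma closed_CKY_multiple : connected [set: M2] ->
  exists c, forall i p, dom i p -> Y i p = c *: r_vol h r i p.
Proof.
(* The empty surface counts as connected; there every constant works. *)
move=> cM; have [[x0 _]|nM] := pselect (exists x : M2, True); last first.
  by exists 0 => i p _; case: nM; exists p.1.
exists (Q1 x0 / r x0) => i p dp.
have -> : Q1 x0 / r x0 = Q1 p.1 / r p.1.
  apply: (pd0_constant mM cM (f := fun y => Q1 y / r y)) => j x C dx.
  exact: ratio_derivative.
rewrite YW // r_volE scale_block_mx !scaler0 scalerA; congr (block_mx (_ *: _) _ _ _).
by rewrite /W mulrA divfK.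
Qed.

End Uniqueness.
End ClosedCKY.

Unset Implicit Arguments.

Theorem propositionV1 (R : realType) (M2 : charted_space R 2)
    (h : tensor2 M2) (r : M2 -> R)
    (M2_manifold : smooth_manifold M2)
    (M2_connected : connected [set: M2])
    (M2_oriented : oriented M2)
    (h_lorentzian : lorentzian h)
    (r_smooth : smooth_fun r)
    (r_gt0 : forall x, 0 < r x)
    (dr_neq0 : forall i x, dom i x -> exists A : 'I_2, pd i A r x != 0) :
  [/\ spherically_symmetric h (r_vol h r),
      closed_CKY (spherical_metric h r) (r_vol h r) &
      forall i p, dom i p ->
        assoc_vector (spherical_metric h r) (r_vol h r) i p
        = kodama_field h r i p]
  /\
  forall Y : tensor2 (prod_space M2 (S2 R)),
    spherically_symmetric h Y ->
    closed_CKY (spherical_metric h r) Y ->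
    exists c : R, forall i p, dom i p ->
      Y i p = c *: r_vol h r i p /\
      assoc_vector (spherical_metric h r) Y i p = c *: kodama_field h r i p.
Proof.
split.
  split.
  - exact: r_vol_symmetric.
  - exact: r_vol_closed_CKY.
  move=> i p dp; rewrite -[RHS]scale1r.
  by apply: assoc_vector_kodama => // q _; rewrite scale1r.
move=> Y [Q1 [Q2 YQ]] cY.
have [c YE] := closed_CKY_multiple M2_manifold h_lorentzian r_smooth r_gt0
  dr_neq0 YQ cY M2_connected.
exists c => i p dp; split; first exact: YE.
by apply: assoc_vector_kodama => // q; exact: YE.
Qed.
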